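(* Let $R$ be a commutative noetherian ring with identity, $\mathfrak{a},\mathfrak{b}$ two ideals of $R$ with $\mathfrak{b}\subseteq\mathfrak{a}$, $X\in\mathrm{D}_\sqsubset(R)$, and let $s\geq0$ and $t\geq-\mathrm{sup}X$ be integers such that (1) $\mathrm{Ext}^{s+t-i}_R(R/\mathfrak{a},\mathrm{H}^{i}_\mathfrak{b}(X))=0$ for all $i$ with $-\mathrm{sup}X\leq i< t$ or $t+1\leq i\leq s+t$; (2) $\mathrm{Ext}^{s+1+i}_R(R/\mathfrak{a},\mathrm{H}^{t-i}_\mathfrak{b}(X))=0$ for all $0\leq i\leq t+\mathrm{sup}X$; (3) $\mathrm{Ext}^{s-1-i}_R(R/\mathfrak{a},\mathrm{H}^{t+i}_\mathfrak{b}(X))=0$ for all $0\leq i\leq s-1$. Then $\mathrm{Ext}^{s+t}_R(R/\mathfrak{a},X)\cong\mathrm{Ext}^{s}_R(R/\mathfrak{a},\mathrm{H}^{t}_\mathfrak{b}(X))$.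
   Context: Complexes are indexed homologically. $\mathrm{D}_\sqsubset(R)$ is the full subcategory of the derived category $\mathrm{D}(R)$ of complexes $X$ with $\mathrm{H}_n(X)=0$ for $n\gg0$, and $\mathrm{sup}X=\sup\{n:\mathrm{H}_n(X)\neq0\}$. For complexes $X,Y$, $\mathrm{Ext}^i_R(X,Y)=\mathrm{H}_{-i}(\mathrm{RHom}_R(X,Y))$. $\Gamma_\mathfrak{b}(M)=\{m\in M:\mathfrak{b}^tm=0\text{ for some }t\}$, $\mathrm{R}\Gamma_\mathfrak{b}$ is its right derived functor, and $\mathrm{H}^i_\mathfrak{b}(X)=\mathrm{H}_{-i}(\mathrm{R}\Gamma_\mathfrak{b}(X))$. *)

(* Defs.v *)
From HB Require Import structures.
From mathcomp Require Import all_boot all_order all_algebra.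
From mathcomp Require Import ring_quotient.
From mathcomp Require Import all_classical constructive_ereal.

Set Implicit Arguments.
Unset Strict Implicit.
Unset Printing Implicit Defensive.

Import Order.TTheory GRing.Theory Num.Theory.

Local Open Scope classical_set_scope.
Local Open Scope ring_scope.

(* [comPzRingType] does not exclude the zero ring. *)

Definition is_zero (R : pzRingType) (M : lmodType R) : Prop :=
  forall x : M, x = 0.

Definition lmod_iso (R : pzRingType) (M N : lmodType R) : Prop :=
  exists f : {linear M -> N}, bijective f.

Section SubmoduleType.
Variables (R : pzRingType) (V : lmodType R) (S : submodClosed V).

Record submod := Submod { submod_val : V; _ : submod_val \in S }.

HB.instance Definition _ := [isSub for submod_val].
HB.instance Definition _ := [Choice of submod by <:].
HB.instance Definition _ := [SubChoice_isSubLmodule of submod by <:].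

End SubmoduleType.

Section SubmoduleMap.
Variables (R : pzRingType) (V W : lmodType R).
Variables (S : submodClosed V) (T : submodClosed W) (f : {linear V -> W}).
Hypothesis fST : forall x, x \in S -> f x \in T.

Definition submod_map (x : submod S) : submod T := Submod (fST (valP x)).

Lemma submod_map_linear : linear submod_map.
Proof. by move=> a x y; apply: val_inj; rewrite /= !linearP. Qed.

HB.instance Definition _ :=
  GRing.isLinear.Build R (submod S) (submod T) _ submod_map submod_map_linear.

End SubmoduleMap.

Section QuotientModule.
Variables (R : pzRingType) (V : lmodType R) (S : submodClosed V).

Lemma quot_pred_closed : zmod_closed S.
Proof. exact: submodClosedP. Qed.

Definition quot_pred : {pred V} := S.

HB.instance Definition _ := GRing.isZmodClosed.Build V quot_pred quot_pred_closed.

Definition quotmod : Type := Quotient.quot quot_pred.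

HB.instance Definition _ := GRing.Zmodule.on quotmod.

Definition quot_pi (x : V) : quotmod := (\pi_(Quotient.quot quot_pred) x)%qT.

Definition quot_repr (x : quotmod) : V := repr (x : Quotient.quot quot_pred).

Definition quot_scale (a : R) (x : quotmod) : quotmod :=
  quot_pi (a *: quot_repr x).

Lemma quot_piP x y : quot_pi x = quot_pi y <-> x - y \in S.
Proof.
have -> : (x - y \in S) = (x == y %[mod Quotient.quot quot_pred])%qT.
  by rewrite -Quotient.idealrBE.
by split=> [/eqP|/eqP].
Qed.

Lemma quot_reprK (x : quotmod) : quot_pi (quot_repr x) = x.
Proof. exact: reprK. Qed.

Lemma quot_piD x y : quot_pi (x + y) = quot_pi x + quot_pi y.
Proof. exact: raddfD. Qed.

Lemma quot_piZ a x : quot_scale a (quot_pi x) = quot_pi (a *: x).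
Proof.
apply/quot_piP; rewrite -scalerBr; apply: rpredZ.
by apply/quot_piP; rewrite quot_reprK.
Qed.

Lemma quot_scaleA a b x : quot_scale a (quot_scale b x) = quot_scale (a * b) x.
Proof. by rewrite -[x]quot_reprK !quot_piZ scalerA. Qed.

Lemma quot_scale1 : left_id 1 quot_scale.
Proof. by move=> x; rewrite -[x]quot_reprK quot_piZ scale1r. Qed.

Lemma quot_scaleDr : right_distributive quot_scale +%R.
Proof.
move=> a x y; rewrite -[x]quot_reprK -[y]quot_reprK -quot_piD !quot_piZ.
by rewrite scalerDr quot_piD.
Qed.

Lemma quot_scaleDl x : {morph quot_scale^~ x : a b / a + b}.
Proof. by move=> a b; rewrite -[x]quot_reprK !quot_piZ scalerDl quot_piD. Qed.

HB.instance Definition _ := GRing.Zmodule_isLmodule.Build R quotmod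
  quot_scaleA quot_scale1 quot_scaleDr quot_scaleDl.

End QuotientModule.

Section KernelImage.
Variables (R : pzRingType) (A B C : lmodType R).
Variables (f : {linear A -> B}) (g : {linear B -> C}).

Definition ker_pred : {pred B} := [pred x | g x == 0].

Lemma ker_pred_closed : submod_closed ker_pred.
Proof.
split=> [|a x y]; rewrite !inE ?linear0 // => /eqP gx /eqP gy.
by rewrite linearP gx gy scaler0 addr0.
Qed.

HB.instance Definition _ :=
  GRing.isSubmodClosed.Build R B ker_pred ker_pred_closed.

(* The image of [f], as a submodule of the kernel of [g], when [g \o f = 0]. *)
Definition im_pred : {pred submod ker_pred} :=
  [pred x | `[< exists y, f y = val x >]].

Lemma im_predP x : reflect (exists y, f y = val x) (x \in im_pred).
Proof. exact: asboolP. Qed.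

Lemma im_pred_closed : submod_closed im_pred.
Proof.
split=> [|a x y]; first by apply/im_predP; exists 0; rewrite linear0.
move=> /im_predP[u ux] /im_predP[v vy]; apply/im_predP; exists (a *: u + v).
by rewrite !linearP /= ux vy.
Qed.

HB.instance Definition _ :=
  GRing.isSubmodClosed.Build R (submod ker_pred) im_pred im_pred_closed.

End KernelImage.

Section Complexes.
Variable R : pzRingType.

(* Differentials are given between any two degrees and vanish unless they
   lower the degree by one; this avoids transports along equations between
   degrees. *)
Record complex := Complex {
  obj :> int -> lmodType R;
  diff : forall i j : int, {linear obj i -> obj j};
  diff_shape : forall i j : int, i != j + 1 -> forall x, diff i j x = 0;
  diff_diff : forall (i j k : int) x, diff j k (diff i j x) = 0 }.

Definition cycles (X : complex) (n : int) : submodClosed (X n) :=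
  ker_pred (diff X n (n - 1)).

Definition boundaries (X : complex) (n : int)
    : submodClosed (submod (cycles X n)) :=
  im_pred (diff X (n + 1) n) (g := diff X n (n - 1)).

Definition homology (X : complex) (n : int) : lmodType R :=
  quotmod (boundaries X n).

Record chain_map (X Y : complex) := ChainMap {
  chain_fun :> forall n, {linear X n -> Y n};
  chain_comm :
    forall i j x, diff Y i j (chain_fun i x) = chain_fun j (diff X i j x) }.

Lemma chain_map_cycles X Y (f : chain_map X Y) n x :
  x \in cycles X n -> f n x \in cycles Y n.
Proof. by rewrite !inE chain_comm => /eqP ->; rewrite linear0. Qed.

Definition homology_map X Y (f : chain_map X Y) n
    (h : homology X n) : homology Y n :=
  quot_pi (boundaries Y n)
    (submod_map (@chain_map_cycles X Y f n) (quot_repr h)).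

Definition quasi_iso X Y (f : chain_map X Y) : Prop :=
  forall n, bijective (@homology_map X Y f n).

Definition homology_bounded_above (X : complex) : Prop :=
  exists N : int, forall n : int, N < n -> is_zero (homology X n).

Definition homology_sup (X : complex) : \bar int :=
  supremum -oo%E [set n%:E%E | n in [set n : int | ~ is_zero (homology X n)]].

(* The module [M] as a complex concentrated in degree 0. *)
Definition stalk_obj (M : lmodType R) (n : int) : lmodType R :=
  if n == 0 then M else 'M[R]_(0, 0).

Program Definition stalk (M : lmodType R) : complex :=
  @Complex (stalk_obj M) (fun i j => \0%R) _ _.
Next Obligation. by []. Qed.
Next Obligation. by []. Qed.

Definition injective_module (E : lmodType R) : Prop :=
  forall (A B : lmodType R) (u : {linear A -> B}) (f : {linear A -> E}),
    injective u -> exists g : {linear B -> E}, forall a, g (u a) = f a.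

Definition is_injective_resolution (X E : complex) : Prop :=
  [/\ exists N : int, forall n : int, N < n -> is_zero (E n),
      forall n, injective_module (E n)
    & exists f : chain_map X E, quasi_iso f].

(* A chosen bounded-above injective resolution. One exists if and only if the
   homology of [X] is bounded above, and it is then unique up to homotopy
   equivalence; otherwise the value is junk. *)
Definition injective_resolution (X : complex) : complex :=
  if pselect (exists E, is_injective_resolution X E) is left ex
  then projT1 (cid ex) else X.

End Complexes.

(* For commutative [R], ideals are submodules of the regular module [R^o]. *)
Notation ideal R := (submodClosed R^o).

Section DerivedFunctors.
Variable R : comPzRingType.

Section Hom.
Variables M N : lmodType R.

Definition hom_pred : {pred M -> N} := [pred f | `[< linear f >]].

Lemma hom_predP f : reflect (linear f) (f \in hom_pred).
Proof. exact: asboolP. Qed.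

Lemma hom_pred_closed : submod_closed hom_pred.
Proof.
split=> [|c f g].
  by apply/hom_predP => a x y; rewrite /= scaler0 addr0.
move=> /hom_predP fl /hom_predP gl; apply/hom_predP => a x y.
change (c *: f (a *: x + y) + g (a *: x + y) =
  a *: (c *: f x + g x) + (c *: f y + g y)).
by rewrite fl gl !scalerDr !scalerA mulrC addrACA.
Qed.

HB.instance Definition _ :=
  GRing.isSubmodClosed.Build R (M -> N) hom_pred hom_pred_closed.

Definition hom_module : lmodType R := submod hom_pred.

End Hom.

Section PostComposition.
Variables (M N P : lmodType R) (g : {linear N -> P}).

Definition postcomp (f : M -> N) : M -> P := g \o f.

Lemma postcomp_linear : linear postcomp.
Proof. by move=> a f h; apply/funext => x; rewrite /postcomp /= linearP. Qed.

HB.instance Definition _ :=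
  GRing.isLinear.Build R (M -> N) (M -> P) _ postcomp postcomp_linear.

Lemma postcomp_hom f : f \in @hom_pred M N -> postcomp f \in @hom_pred M P.
Proof.
move=> /hom_predP fl; apply/hom_predP => a x y.
by rewrite /postcomp /= fl linearP.
Qed.

Definition hom_map : {linear hom_module M N -> hom_module M P} := submod_map postcomp_hom.

End PostComposition.

Program Definition hom_complex (M : lmodType R) (X : complex R) : complex R :=
  @Complex R (fun n => hom_module M (X n)) (fun i j => hom_map M (diff X i j)) _ _.
Next Obligation.
by move=> M X i j ij x; apply: val_inj; apply/funext => y; exact: diff_shape.
Qed.
Next Obligation.
by move=> M X i j k x; apply: val_inj; apply/funext => y; exact: diff_diff.
Qed.

Definition noetherian : Prop :=
  forall I : ideal R, exists (n : nat) (g : 'I_n -> R),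
    forall x : R, x \in I <-> exists c : 'I_n -> R, x = \sum_i c i * g i.

Definition unit_ideal_pred : {pred R^o} := predT.

Lemma unit_ideal_closed : submod_closed unit_ideal_pred.
Proof. by []. Qed.

HB.instance Definition _ :=
  GRing.isSubmodClosed.Build R R^o unit_ideal_pred unit_ideal_closed.

Definition ideal_mul_pred (I J : ideal R) : {pred R^o} :=
  [pred x | `[< exists (n : nat) (f g : 'I_n -> R),
      [/\ forall i, f i \in I, forall i, g i \in J
        & x = \sum_i f i * g i] >]].

Lemma ideal_mul_predP (I J : ideal R) (x : R) :
  reflect (exists (n : nat) (f g : 'I_n -> R),
      [/\ forall i, f i \in I, forall i, g i \in J
        & x = \sum_i f i * g i])
    (x \in ideal_mul_pred I J).
Proof. exact: asboolP. Qed.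

Lemma ideal_mul_closed I J : submod_closed (ideal_mul_pred I J).
Proof.
split=> [|a x y].
  by apply/ideal_mul_predP; exists 0%N, (fun=> 0), (fun=> 0);
    split=> [[]|[]|] //; rewrite big_ord0.
move=> /ideal_mul_predP[m [f [g [fI gJ ->]]]].
move=> /ideal_mul_predP[n [f' [g' [f'I g'J ->]]]].
apply/ideal_mul_predP; exists (m + n)%N,
  (fun i => match fintype.split i with inl j => a * f j | inr j => f' j end),
  (fun i => match fintype.split i with inl j => g j | inr j => g' j end).
split=> [i|i|]; first by case: (fintype.split i) => // j; apply: (rpredZ a).
  by case: (fintype.split i).
rewrite big_split_ord /=; congr (_ + _).
  rewrite /GRing.scale /= mulr_sumr; apply: eq_bigr => i _.
  by rewrite (unsplitK (inl i)) mulrA.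
by apply: eq_bigr => i _; rewrite (unsplitK (inr i)).
Qed.

HB.instance Definition _ I J :=
  GRing.isSubmodClosed.Build R R^o (ideal_mul_pred I J) (ideal_mul_closed I J).

Fixpoint ideal_exp (I : ideal R) (n : nat) : ideal R :=
  if n is n'.+1 then ideal_mul_pred I (ideal_exp I n') else unit_ideal_pred.

Section Torsion.
Variables (b : ideal R) (M : lmodType R).

Definition torsion_pred : {pred M} :=
  [pred m | `[< exists t : nat, forall x : R, x \in ideal_exp b t -> x *: m = 0 >]].

Lemma torsion_predP m :
  reflect (exists t : nat, forall x : R, x \in ideal_exp b t -> x *: m = 0)
    (m \in torsion_pred).
Proof. exact: asboolP. Qed.

Lemma ideal_expS_sub (n : nat) x :
  x \in ideal_exp b n.+1 -> x \in ideal_exp b n.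
Proof.
move=> /ideal_mul_predP[m [f [g [_ gI ->]]]].
by apply: rpred_sum => i _; apply: (rpredZ (f i)).
Qed.

Lemma ideal_exp_sub (m n : nat) x :
  x \in ideal_exp b (m + n) -> x \in ideal_exp b n.
Proof. by elim: m => // m IHm /ideal_expS_sub. Qed.

Lemma torsion_pred_closed : submod_closed torsion_pred.
Proof.
split=> [|a u v].
  by apply/torsion_predP; exists 0%N => x _; rewrite scaler0.
move=> /torsion_predP[m um] /torsion_predP[n vn]; apply/torsion_predP; exists (m + n)%N => x xI.
rewrite scalerDr vn ?(ideal_exp_sub xI)// addr0 scalerA mulrC -scalerA um ?scaler0//.
by move: xI; rewrite addnC => /ideal_exp_sub.
Qed.

HB.instance Definition _ :=
  GRing.isSubmodClosed.Build R M torsion_pred torsion_pred_closed.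

Definition torsion : lmodType R := submod torsion_pred.

End Torsion.

Section TorsionMap.
Variables (b : ideal R) (M N : lmodType R) (f : {linear M -> N}).

Lemma torsion_pred_map x : x \in @torsion_pred b M -> f x \in @torsion_pred b N.
Proof.
move=> /torsion_predP[t xt]; apply/torsion_predP; exists t => a /xt ax.
by rewrite -linearZ ax linear0.
Qed.

Definition torsion_map : {linear torsion b M -> torsion b N} :=
  submod_map torsion_pred_map.

End TorsionMap.

Program Definition torsion_complex (b : ideal R) (X : complex R) : complex R :=
  @Complex R (fun n => torsion b (X n)) (fun i j => torsion_map b (diff X i j)) _ _.
Next Obligation. by move=> b X i j ij x; apply: val_inj; exact: diff_shape. Qed.
Next Obligation. by move=> b X i j k x; apply: val_inj; exact: diff_diff. Qed.

(* A module [M] in the first argument stands for a complex concentrated in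
   degree 0, so that the Hom complex is [Hom_R(M, E_n)] in degree [n]. *)
Definition RHom (M : lmodType R) (X : complex R) : complex R :=
  hom_complex M (injective_resolution X).

Definition RGamma (b : ideal R) (X : complex R) : complex R :=
  torsion_complex b (injective_resolution X).

Definition Ext (i : int) (M : lmodType R) (X : complex R) : lmodType R :=
  homology (RHom M X) (- i).

Definition local_cohomology (b : ideal R) (i : int) (X : complex R) : lmodType R :=
  homology (RGamma b X) (- i).

End DerivedFunctors.

(* Main.v *)
(** Write [q0 = - sup X] and let [J] be the torsion subcomplex of a bounded
    above injective resolution of [X].  Over a noetherian ring [J] is again a
    complex of injectives; its cohomology is the local cohomology of [X], which
    vanishes below degree [q0], and [Hom(R/a, J)] computes [Ext(R/a, X)] because
    maps out of [R/a] take values in the [b]-torsion.  Instead of the spectral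
    sequence with second page [Ext^p(R/a, H^q(J))], the cohomology modules are
    removed one at a time from below: if [H^q(J)] is the lowest one and [E]
    resolves it, the projection of the cocycles onto [H^q(J)] has a section
    (the exact part of [J] below degree [q] splits), which extends to a chain
    map from [E], shifted by [q], to [J].  Its cone [C] is again a bounded above
    complex of injectives, it has the cohomology of [J] in degrees above [q] and
    none elsewhere, and the long exact sequence of [Hom(R/a, -)] relates
    [Ext^(m-q)(R/a, H^q(J))], [H^m(Hom(R/a, J))] and [H^m(Hom(R/a, C))].
    Removing the degrees below [t] does not change [H^(s+t)(Hom(R/a, -))], by
    (1) and (2); removing degree [t] as well leaves a complex for which it
    vanishes in degrees [s + t] and [s + t - 1], by (1) and (3). *)

Require Import Defs.
From HB Require Import structures.
From mathcomp Require Import all_boot all_order all_algebra.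
From mathcomp Require Import all_classical constructive_ereal.
From mathcomp Require Import zify.

Set Implicit Arguments.
Unset Strict Implicit.
Unset Printing Implicit Defensive.

Import Order.TTheory GRing.Theory Num.Theory.

Local Open Scope classical_set_scope.
Local Open Scope ring_scope.

(** * Linear relations and injectivity *)

Section PackLinear.
Variables (R : pzRingType) (A B : lmodType R) (f : A -> B) (lin_f : linear f).

Definition pack_linear_fun (x : A) : B := f x.

HB.instance Definition _ :=
  GRing.isLinear.Build R A B _ pack_linear_fun lin_f.

Definition pack_linear : {linear A -> B} := pack_linear_fun.

End PackLinear.

Section PackSubmod.
Variables (R : pzRingType) (V : lmodType R) (P : V -> Prop).
Hypotheses (P0 : P 0) (PD : forall c x y, P x -> P y -> P (c *: x + y)).

Definition prop_pred : {pred V} := [pred x | `[< P x >]].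

Lemma prop_predP x : reflect (P x) (x \in prop_pred).
Proof. exact: asboolP. Qed.

Lemma prop_pred_closed : submod_closed prop_pred.
Proof.
split=> [|c x y]; first exact/prop_predP.
by move=> /prop_predP Px /prop_predP Py; apply/prop_predP/PD.
Qed.

HB.instance Definition _ :=
  GRing.isSubmodClosed.Build R V prop_pred prop_pred_closed.

Definition pack_submod : submodClosed V := prop_pred.

Lemma pack_submodP x : x \in pack_submod <-> P x.
Proof. by split=> /prop_predP. Qed.

End PackSubmod.

Lemma quot_pi_eq0 (R : pzRingType) (V : lmodType R) (S : submodClosed V) x :
  quot_pi S x = 0 <-> x \in S.
Proof.
have -> : 0 = quot_pi S 0 by apply/esym/(addrI (quot_pi S 0)); rewrite -quot_piD !addr0.
by split=> [/quot_piP|xS]; [|apply/quot_piP]; rewrite subr0.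
Qed.

Section LinearRelations.
Variable R : pzRingType.

(** Together with [functional_rel] this encodes, by its graph, a linear map defined on a submodule
    of [A]; partial maps can then be given by formulas, with no choice of representatives. *)
Definition linear_rel (A B : lmodType R) (G : A -> B -> Prop) : Prop :=
  G 0 0 /\ forall c a b a' b', G a b -> G a' b' -> G (c *: a + a') (c *: b + b').

Definition functional_rel (A B : lmodType R) (G : A -> B -> Prop) : Prop :=
  forall b, G 0 b -> b = 0.

Lemma linear_rel_uniq (A B : lmodType R) (G : A -> B -> Prop) a b b' :
  linear_rel G -> functional_rel G -> G a b -> G a b' -> b = b'.
Proof.
move=> [_ GD] Gf Gb Gb'; apply/eqP; rewrite -subr_eq0; apply/eqP/Gf.
have := GD (-1) _ _ _ _ Gb' Gb.
by rewrite !scaleN1r addNr addrC.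
Qed.

Lemma linear_rel_fun (A B : lmodType R) (G : A -> B -> Prop) :
    linear_rel G -> functional_rel G -> (forall a, exists b, G a b) ->
  exists g : {linear A -> B}, forall a, G a (g a).
Proof.
move=> Gl Gf /choice[g Gg].
have lin_g : linear g.
  move=> c x y; apply: (linear_rel_uniq Gl Gf (Gg _)).
  exact: Gl.2.
by exists (pack_linear lin_g).
Qed.

Definition rel_extendable (E : lmodType R) : Prop :=
  forall (A : lmodType R) (G : A -> E -> Prop),
    linear_rel G -> functional_rel G ->
  exists g : {linear A -> E}, forall a b, G a b -> g a = b.

Lemma injective_rel_extendable (E : lmodType R) :
  injective_module E -> rel_extendable E.
Proof.
move=> injE A G Gl Gf.
have D0 : exists y, G 0 y by exists 0; case: Gl.
have DD c x y : (exists z, G x z) -> (exists z, G y z) ->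
    exists z, G (c *: x + y) z.
  by case: Gl => _ GD [z Gz] [w Gw]; exists (c *: z + w); apply: GD.
pose D := pack_submod D0 DD.
have [|||f Gfx] := @linear_rel_fun (submod D) E (fun x y => G (val x) y).
- by case: Gl => G0 GD; split=> [|c x y x' y']; [|rewrite linearP; apply: GD].
- by move=> y /Gf.
- by case=> x /= xD; apply/(pack_submodP D0 DD).
have [|g gE] := injE _ _ (val : {linear submod D -> A}) f; first exact: val_inj.
exists g => a b Gab.
have aD : a \in D by apply/(pack_submodP D0 DD); exists b.
have := gE (Submod aD); rewrite /= => ->.
exact: linear_rel_uniq Gl Gf (Gfx (Submod aD)) Gab.
Qed.

Lemma rel_extendable_injective (E : lmodType R) :
  rel_extendable E -> injective_module E.
Proof.
move=> extE A B u f inj_u.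
have [||g gE] := extE B (fun b y => exists2 a, u a = b & f a = y).
- split=> [|c _ _ _ _ [a <- <-] [a' <- <-]].
    by exists 0; rewrite linear0.
  by exists (c *: a + a'); rewrite linearP.
- move=> y [a ua <-]; suff -> : a = 0 by rewrite linear0.
  by apply: inj_u; rewrite linear0.
by exists g => a; apply: gE; exists a.
Qed.

Lemma maximal_functional_rel (B E : lmodType R) (G0 : B -> E -> Prop) :
    linear_rel G0 -> functional_rel G0 ->
  exists G : B -> E -> Prop,
    [/\ linear_rel G, functional_rel G, forall b y, G0 b y -> G b y
      & forall G' : B -> E -> Prop, linear_rel G' -> functional_rel G' ->
          (forall b y, G b y -> G' b y) -> forall b y, G' b y -> G b y].
Proof.
move=> G0l G0f.
(* [G0] is joined to every set, so that the union of the empty chain still gives a linear graph. *)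
pose rel (X : set (B * E)) b y := G0 b y \/ X (b, y).
pose P X := linear_rel (rel X) /\ functional_rel (rel X).
have [|X [[Xl Xf] maxX]] := @Zorn_bigcup (B * E)%type P.
  move=> F FP Ftot.
  have comp b y b' y' : rel (\bigcup_(X in F) X) b y ->
      rel (\bigcup_(X in F) X) b' y' ->
    (G0 b y /\ G0 b' y') \/ (exists X, [/\ F X, rel X b y & rel X b' y']).
    case=> [g|[X FX Xb]] [g'|[X' FX' Xb']].
    - by left.
    - by right; exists X'; split=> //; [left|right].
    - by right; exists X; split=> //; [right|left].
    case: (Ftot _ _ FX FX') => sub.
      by right; exists X'; split=> //; right=> //; apply: sub.
    by right; exists X; split=> //; right=> //; apply: sub.
  split.
    split=> [|c b y b' y' /comp/[apply]]; first by left; case: G0l.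
    case=> [[g g']|[X [FX Xb Xb']]]; first by left; apply: G0l.2.
    have [[_ /(_ c _ _ _ _ Xb Xb')[g|XX]] _] := FP _ FX; first by left.
    by right; exists X.
  move=> y Gy; case: (comp _ _ _ _ Gy Gy) => [[g _]|[X [FX Xy _]]].
    exact: G0f.
  by have [_ ] := FP _ FX; apply.
exists (rel X); split=> //; first by left.
move=> G' G'l G'f sub b y G'b; apply: contrapT => nX.
pose X' : set (B * E) := [set p | G' p.1 p.2].
have relX' b' y' : rel X' b' y' <-> G' b' y'.
  by split=> [[g|]|] //; [apply: sub; left|right].
apply: (maxX X').
  split=> [[b' y'] Xb'|/(_ (b, y) G'b) Xb]; first by apply: sub; right.
  by apply: nX; right.
split; last by move=> z /relX'/G'f.
split=> [|c b1 y1 b2 y2 /relX' g1 /relX' g2]; apply/relX'; first by case: G'l.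
exact: G'l.2.
Qed.

(* A weakening of Baer's criterion: it is enough to extend a map defined on a
   proper ideal to one further element of the ring. *)
Lemma one_step_extendable (E : lmodType R) :
    (forall G : R^o -> E -> Prop, linear_rel G -> functional_rel G ->
      ~ (exists e, G 1 e) ->
      exists (r : R) (e : E), ~ (exists e', G r e') /\
        forall (c : R) y, G (c * r) y -> y = c *: e) ->
  rel_extendable E.
Proof.
move=> step B G0 G0l G0f.
have [G [Gl Gf subG maxG]] := maximal_functional_rel G0l G0f.
have [G00 GD] := Gl.
suff Gt b : exists y, G b y.
  have [g gG] := linear_rel_fun Gl Gf Gt.
  by exists g => a b /subG; apply: linear_rel_uniq (gG a).
apply: contrapT => nGb.
(* As [b] lies outside the domain of [G], the elements [c] with [c *: b] in the domain form a proper
   ideal. *)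
have [||[e]|r [e [nr rE]]] := step (fun (c : R) y => G (c *: b) y).
- split=> [|c x y x' y' Gx Gx']; first by rewrite scale0r.
  by rewrite [_ *: _ + _](_ : _ = (c * x + x') :> R)// scalerDl -scalerA; apply: GD.
- by move=> y; rewrite scale0r => /Gf.
- by rewrite scale1r => Gbe; apply: nGb; exists e.
apply: nr; exists e.
(* [G] enlarged by [r *: b |-> e]. By [rE] it is still functional, so maximality puts [r *: b] in
   the domain of [G], against [nr]. *)
pose G' x y := exists b0 y0 c,
  [/\ G b0 y0, x = b0 + c *: (r *: b) & y = y0 + c *: e].
apply: (maxG G').
- split=> [|c _ _ _ _ [b1 [y1 [c1 [g1 -> ->]]]] [b2 [y2 [c2 [g2 -> ->]]]]].
    by exists 0, 0, 0; split; rewrite ?scale0r ?addr0.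
  exists (c *: b1 + b2), (c *: y1 + y2), (c * c1 + c2); split; first exact: GD.
    by rewrite !scalerDr !scalerDl -!scalerA addrACA.
  by rewrite !scalerDr !scalerDl -!scalerA addrACA.
- move=> y [b0 [y0 [c [g0 /esym/eqP]]]]; rewrite addr_eq0 => /eqP b0E ->.
  have : G ((- c * r) *: b) y0 by rewrite mulNr scaleNr -scalerA -b0E.
  by move=> /rE ->; rewrite scaleNr addNr.
- by move=> x y g; exists x, y, 0; rewrite !scale0r !addr0; split.
by exists 0, 0, 1; split; rewrite ?scale1r ?add0r.
Qed.

End LinearRelations.

(** * Enough injective modules *)

(** Euclidean division by the least positive element of the ideal; [d] is 0 if there is none. *)
Lemma int_ideal_principal (P : int -> Prop) :
    P 0 -> (forall c x y, P x -> P y -> P (c * x + y)) ->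
  exists d : int, forall c, P c <-> (d %| c)%Z.
Proof.
move=> P0 PD.
have PM c x : P x -> P (c * x) by move=> Px; rewrite -[_ * _]addr0; apply: PD.
case: (pselect (exists n : nat, `[< P n.+1%:Z >])) => [ex|nex]; last first.
  exists 0 => c; rewrite dvd0z; split=> [Pc|/eqP->//].
  apply: contrapT => /negP c0; apply: nex; exists `|c|%N.-1.
  apply/asboolP; rewrite prednK ?absz_gt0//.
  have := PM (sgz c) c Pc; suff -> : sgz c * c = `|c|%N%:Z by [].
  by rewrite -abszEsg.
case: (ex_minnP ex) => d /asboolP Pd dmin.
exists d.+1%:Z => c; split=> [Pc|/dvdzP[q ->]]; last exact: PM.
have Pr : P (c %% d.+1)%Z.
  have -> : (c %% d.+1)%Z = - (c %/ d.+1)%Z * d.+1 + c.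
    by rewrite {3}(divz_eq c d.+1) mulNr addrA addNr add0r.
  exact: PD.
apply/dvdz_mod0P; apply: contrapT => r0.
have r_ge : 0 <= (c %% d.+1)%Z by apply: modz_ge0.
have r_lt : (c %% d.+1)%Z < d.+1 by apply: ltz_pmod.
case: (c %% d.+1)%Z r_ge r_lt r0 Pr => // -[|r] // _ r_lt _ Pr.
by have := dmin r; rewrite (asboolT Pr) => /(_ isT); lia.
Qed.

(** A map on the ideal generated by [d] is determined by its value [w] at [d], and any [e] with
    [d *: e = w] can serve as the image of 1. *)
Lemma divisible_extendable (D : lmodType int) :
    (forall (n : int) (w : D), n != 0 -> exists e, n *: e = w) ->
  rel_extendable D.
Proof.
move=> divD; apply: one_step_extendable => G Gl Gf n1.
exists 1.
have [|c x y [z Gz] [w Gw]|d dG] :=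
    int_ideal_principal (P := fun c => exists y, G c y).
- by exists 0; case: Gl.
- by exists (c *: z + w); apply: Gl.2.
have [d0|d0] := eqVneq d 0.
  exists 0; split=> // c y; rewrite mulr1 => Gcy.
  have /dG : exists y, G c y by exists y.
  by rewrite d0 dvd0z => /eqP c0; move: Gcy; rewrite c0 scaler0 => /Gf.
have [w Gw] : exists w, G d w by apply/dG; exact: dvdzz.
have [e de] := divD d w d0; exists e; split=> // c y; rewrite mulr1 => Gcy.
have /dG/dvdzP[q cE] : exists y, G c y by exists y.
rewrite cE -scalerA de; apply: (linear_rel_uniq Gl Gf Gcy).
by have := Gl.2 q _ _ _ _ Gw Gl.1; rewrite cE !addr0.
Qed.

Definition integral_rat (x : zmodule rat) : Prop := exists n : int, x = n%:~R :> rat.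

Lemma integral_rat0 : integral_rat 0.
Proof. by exists 0. Qed.

Lemma integral_ratD (c : int) x y :
  integral_rat x -> integral_rat y -> integral_rat (c *: x + y).
Proof.
move=> [m ->] [n ->]; exists (c * m + n).
by rewrite scalezrE rmorphD rmorphM /= -mulrzl.
Qed.

Definition integral_rats : submodClosed (zmodule rat) :=
  pack_submod integral_rat0 integral_ratD.

Definition QmodZ : lmodType int := quotmod integral_rats.

Lemma QmodZ_extendable : rel_extendable QmodZ.
Proof.
apply: divisible_extendable => n w n0.
exists (quot_pi integral_rats ((quot_repr w : rat) / n%:~R : rat)).
rewrite -[w in RHS]quot_reprK [LHS]quot_piZ; congr quot_pi.
by rewrite scalezrE -mulrzl mulrC divfK// intr_eq0.
Qed.

(** On the multiples of [m] the map sends [m] to the class of [1 / n], with [n] a generator of the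
    annihilator of [m]; it then extends to [M]. *)
Lemma QmodZ_separates (M : lmodType int) (m : M) :
  m != 0 -> exists f : {linear M -> QmodZ}, f m != 0.
Proof.
move=> m0.
have [||d dP] := int_ideal_principal (P := fun c => c *: m = 0).
- by rewrite scale0r.
- by move=> c x y xm ym; rewrite scalerDl -scalerA xm ym scaler0 addr0.
(* If [m] has infinite order, any nonzero non-unit can replace the generator. *)
pose n := if d == 0 then 2 else d.
have n0 : n != 0 by rewrite /n; case: (eqVneq d 0).
have n1 : ~~ (n %| 1)%Z.
  rewrite /n; case: (eqVneq d 0) => // d0.
  by apply: contra m0 => /dP; rewrite scale1r => ->.
pose w : QmodZ := quot_pi integral_rats (n%:~R^-1 : rat).
have wE c : c *: w = 0 <-> (n %| c)%Z.
  rewrite [c *: w]quot_piZ.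
  split=> [/quot_pi_eq0/pack_submodP[q]|/dvdzP[q ->]].
    rewrite scalezrE -mulrzl.
    move=> /(congr1 (fun x => x * n%:~R)); rewrite divfK ?intr_eq0//.
    by rewrite -rmorphM => /intr_inj ->; apply/dvdzP; exists q.
  apply/quot_pi_eq0/pack_submodP; exists q.
  by rewrite scalezrE -mulrzl rmorphM /= mulfK// intr_eq0.
have [||f fE] := QmodZ_extendable
    (G := fun (x : M) y => exists c : int, x = c *: m /\ y = c *: w).
- split=> [|c _ _ _ _ [a [-> ->]] [b [-> ->]]].
    by exists 0; rewrite !scale0r.
  by exists (c * a + b); rewrite !scalerDl -!scalerA.
- move=> y [c [/esym/dP dc ->]]; apply/wE; rewrite /n.
  by case: (eqVneq d 0) dc => [->|//]; rewrite dvd0z => /eqP ->; rewrite dvdz0.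
exists f; apply: contra n1 => /eqP fm; apply/wE; rewrite scale1r -fm.
by rewrite (fE _ w)//; exists 1; rewrite !scale1r.
Qed.

Lemma fun_extendable (R : pzRingType) (T : Type) (E : lmodType R) :
  rel_extendable E -> rel_extendable (T -> E).
Proof.
move=> extE A G Gl Gf.
have /choice[g gE] t : exists g : {linear A -> E}, forall a f, G a f -> g a = f t.
  have [||g gE] := extE A (fun a y => exists2 f, G a f & y = f t).
  - split=> [|c a _ a' _ [f Gf1 ->] [f' Gf' ->]]; first by exists 0 => //; case: Gl.
    by exists (c *: f + f') => //; apply: Gl.2.
  - by move=> y [f /Gf -> ->].
  by exists g => a f Gaf; apply: gE; exists f.
have lin_h : linear (fun a t => g t a).
  by move=> c x y; apply/funext => t; rewrite linearP.
by exists (pack_linear lin_h) => a f Gaf; apply/funext => t; apply: gE.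
Qed.

Section Coinduced.
Variables (R : comPzRingType) (D : lmodType int).

Definition additive_fun (f : R -> D) : Prop :=
  forall x y, f (x + y) = f x + f y.

Lemma additive_fun0 : additive_fun 0.
Proof. by move=> x y; rewrite addr0. Qed.

Lemma additive_funD (c : int) f g :
  additive_fun f -> additive_fun g -> additive_fun (c *: f + g).
Proof.
move=> fD gD x y.
change (c *: f (x + y) + g (x + y) = (c *: f x + g x) + (c *: f y + g y)).
by rewrite fD gD scalerDr addrACA.
Qed.

(** Hom over the integers from [R] to [D]: the right adjoint of restriction of scalars, which
    therefore preserves injectives. *)
Definition coind : Type := submod (pack_submod additive_fun0 additive_funD).

HB.instance Definition _ := GRing.Zmodule.on coind.

Definition coind_fun (f : coind) : R -> D := val f.

Lemma coind_funP f : additive_fun (coind_fun f).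
Proof. by case: f => f fP; apply/(pack_submodP additive_fun0 additive_funD). Qed.

Definition pack_coind f (fD : additive_fun f) : coind :=
  Submod ((pack_submodP additive_fun0 additive_funD f).2 fD).

Lemma coindP (f g : coind) : coind_fun f =1 coind_fun g -> f = g.
Proof. by move=> fg; apply/val_inj/funext. Qed.

Lemma coind_funD f g r : coind_fun (f + g) r = coind_fun f r + coind_fun g r.
Proof. by []. Qed.

Definition coind_eval (r : R) (f : coind) : D := coind_fun f r.

Lemma coind_eval_zmod_morphism r : zmod_morphism (coind_eval r).
Proof. by []. Qed.

HB.instance Definition _ r := GRing.isZmodMorphism.Build coind D (coind_eval r)
  (coind_eval_zmod_morphism r).

Lemma coind_funMz (f : coind) (c : int) r : coind_fun (f *~ c) r = c *: coind_fun f r.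
Proof. by rewrite -[LHS]/(coind_eval r (f *~ c)) raddfMz -scaler_int intz. Qed.

Lemma coind_scale_subproof (a : R) (f : coind) :
  additive_fun (fun r => coind_fun f (r * a)).
Proof. by move=> x y; rewrite mulrDl coind_funP. Qed.

Definition coind_scale a f : coind := pack_coind (coind_scale_subproof a f).

Lemma coind_fun_scale a r f : coind_fun (coind_scale a f) r = coind_fun f (r * a).
Proof. by []. Qed.

Lemma coind_scaleA a b f : coind_scale a (coind_scale b f) = coind_scale (a * b) f.
Proof. by apply: coindP => r; rewrite !coind_fun_scale mulrA. Qed.

Lemma coind_scale1 : left_id 1 coind_scale.
Proof. by move=> f; apply: coindP => r; rewrite coind_fun_scale mulr1. Qed.

Lemma coind_scaleDr : right_distributive coind_scale +%R.
Proof. by move=> a f g; apply: coindP. Qed.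

Lemma coind_scaleDl f : {morph coind_scale^~ f : a b / a + b}.
Proof.
move=> a b; apply: coindP => r.
by rewrite coind_funD !coind_fun_scale mulrDr coind_funP.
Qed.

HB.instance Definition _ := GRing.Zmodule_isLmodule.Build R coind
  coind_scaleA coind_scale1 coind_scaleDr coind_scaleDl.

Lemma coind_funZ (a r : R) (f : coind) : coind_fun (a *: f) r = coind_fun f (r * a).
Proof. by []. Qed.

(** By adjunction: the partial map followed by evaluation at 1 extends to an additive [g], and
    [a |-> (r |-> g (r *: a))] extends the original map. *)
Lemma coind_extendable : rel_extendable D -> rel_extendable (coind : lmodType R).
Proof.
move=> extD A G Gl Gf.
have [||g gE] := extD (zmodule A) (fun a y => exists2 f, G a f & y = coind_fun f 1).
- split=> [|c a _ a' _ [f Gaf ->] [f' Gaf' ->]]; first by exists 0 => //; case: Gl.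
  exists (c%:~R *: f + f').
    by rewrite scalezrE -scaler_int; apply: Gl.2.
  by rewrite scaler_int coind_funD coind_funMz.
- by move=> y [f /Gf -> ->].
have hD a : additive_fun (fun r => g (r *: a : A)).
  by move=> x y; rewrite scalerDl raddfD.
have lin_h : linear (fun a => pack_coind (hD a)).
  move=> c x y; apply: coindP => r; rewrite coind_funD coind_funZ /coind_fun/=.
  by rewrite scalerDr scalerA raddfD.
exists (pack_linear lin_h) => a f Gaf; apply: coindP => r.
change (g (r *: a : A) = coind_fun f r).
rewrite (gE _ (coind_fun f r))//; exists (r *: f); last first.
  by rewrite coind_funZ mul1r.
by have := Gl.2 r _ _ _ _ Gaf Gl.1; rewrite !addr0.
Qed.

End Coinduced.

(** [M] embeds in the module coinduced from a product of copies of [QmodZ] indexed by [M] itself;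
    the factor of index [k] carries a character that is nonzero at [k]. *)
Lemma enough_injectives (R : comPzRingType) (M : lmodType R) :
  exists (E : lmodType R) (f : {linear M -> E}),
    rel_extendable E /\ forall x, f x = 0 -> x = 0.
Proof.
have /choice[chi chiP] (k : M) :
    exists f : {linear zmodule M -> QmodZ}, k <> 0 -> f k != 0.
  have [->|/QmodZ_separates[f fk]] := eqVneq (k : zmodule M) 0; first by exists \0%R.
  by exists f.
have fD m : additive_fun (fun (r : R) k => chi k (r *: m : M)).
  by move=> x y; apply/funext => k; rewrite scalerDl raddfD.
have lin_f : linear (fun m => pack_coind (fD m)).
  move=> c x y; apply: coindP => r; apply/funext => k.
  rewrite coind_funD coind_funZ /coind_fun/=.
  change (chi k (r *: (c *: x + y) : M) = chi k ((r * c) *: x : M) + chi k (r *: y : M)).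
  by rewrite scalerDr scalerA raddfD.
exists (coind R (M -> QmodZ)), (pack_linear lin_f); split.
  exact/coind_extendable/fun_extendable/QmodZ_extendable.
move=> x fx; apply: contrapT => /chiP/eqP; apply.
have := congr1 (fun f => coind_fun f 1 x) fx.
by rewrite /coind_fun/= scale1r.
Qed.

(** * Homology by elements *)

Lemma linear_bijective (R : pzRingType) (A B : lmodType R) (f : {linear A -> B}) :
    (forall x, f x = 0 -> x = 0) -> (forall y, exists x, f x = y) ->
  bijective f.
Proof.
move=> inj_f /choice[g fg]; exists g => // x.
by apply/eqP; rewrite -subr_eq0; apply/eqP/inj_f; rewrite linearB /= fg subrr.
Qed.

Section LmodIso.
Variable R : pzRingType.
Implicit Types M N P : lmodType R.

Lemma lmod_iso_refl M : lmod_iso M M.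
Proof. by exists idfun; exists id. Qed.

Lemma lmod_iso_sym M N : lmod_iso M N -> lmod_iso N M.
Proof.
move=> [f [g fg gf]].
have lin_g : linear g.
  by move=> a x y; rewrite -{1}[x]gf -{1}[y]gf -linearP fg.
by exists (pack_linear lin_g); exists f.
Qed.

Lemma lmod_iso_trans M N P : lmod_iso M N -> lmod_iso N P -> lmod_iso M P.
Proof.
move=> [f bf] [g bg]; exists (g \o f : {linear M -> P}).
exact: bij_comp.
Qed.

Lemma lmod_iso_is_zero M N : lmod_iso M N -> is_zero M -> is_zero N.
Proof. by move=> [f [g _ gf]] M0 y; rewrite -[y]gf (M0 (g y)) linear0. Qed.

End LmodIso.

Section HomologyElements.
Variable R : pzRingType.
Implicit Types X Y : complex R.

(* Quantifying over the neighbouring degree is harmless, since differentials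
   between degrees that are not consecutive vanish; it avoids rewriting
   [n - 1 + 1] into [n]. *)
Definition cyc X n (x : X n) : Prop := forall m, diff X n m x = 0.

Definition bd X n (x : X n) : Prop := exists m y, diff X m n y = x.

Definition exact_at X n : Prop := forall x : X n, cyc x -> bd x.

Lemma cycP X n (x : X n) : x \in cycles X n <-> cyc x.
Proof.
split=> [/eqP x0 m|x0]; last by rewrite inE; apply/eqP/x0.
by have [->|nm] := eqVneq m (n - 1); last by apply: diff_shape; lia.
Qed.

Lemma bdP X n (x : X n) : bd x <-> exists y, diff X (n + 1) n y = x.
Proof.
split=> [[m [y <-]]|[y <-]]; last by exists (n + 1), y.
have [E|nm] := eqVneq m (n + 1); first by subst m; exists y.
by exists 0; rewrite linear0 diff_shape.
Qed.

Lemma cyc_diff X m n (x : X m) : cyc (diff X m n x).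
Proof. by move=> k; apply: diff_diff. Qed.

Lemma bd_diff X m n (x : X m) : bd (diff X m n x).
Proof. by exists m, x. Qed.

Lemma cycD X n c (x y : X n) : cyc x -> cyc y -> cyc (c *: x + y).
Proof. by move=> x0 y0 m; rewrite linearP /= x0 y0 scaler0 addr0. Qed.

Lemma bdD X n c (x y : X n) : bd x -> bd y -> bd (c *: x + y).
Proof.
move=> /bdP[u <-] /bdP[v <-]; apply/bdP; exists (c *: u + v).
by rewrite linearP.
Qed.

Lemma cyc0 X n : cyc (0 : X n).
Proof. by move=> m; rewrite linear0. Qed.

Lemma bd0 X n : bd (0 : X n).
Proof. by exists n, 0; rewrite linear0. Qed.

Lemma cyc_add X n (x y : X n) : cyc x -> cyc y -> cyc (x + y).
Proof. by rewrite -[x]scale1r => x0; apply: cycD; rewrite -[x]scale1r. Qed.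

Lemma bd_add X n (x y : X n) : bd x -> bd y -> bd (x + y).
Proof. by move=> x0; rewrite -[x]scale1r; apply: bdD. Qed.

Lemma cyc_opp X n (x : X n) : cyc x -> cyc (- x).
Proof.
by move=> x0; rewrite -scaleN1r -[_ *: _]addr0; apply: cycD => //; apply: cyc0.
Qed.

Lemma bd_opp X n (x : X n) : bd x -> bd (- x).
Proof.
by move=> x0; rewrite -scaleN1r -[_ *: _]addr0; apply: bdD => //; apply: bd0.
Qed.

Lemma cyc_sub X n (x y : X n) : cyc x -> cyc y -> cyc (x - y).
Proof. by move=> x0 /cyc_opp; apply: cyc_add. Qed.

Lemma bd_sub X n (x y : X n) : bd x -> bd y -> bd (x - y).
Proof. by move=> x0 /bd_opp; apply: bd_add. Qed.

Definition hclass X n (x : X n) (x0 : cyc x) : homology X n :=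
  quot_pi (boundaries X n) (Submod ((cycP x).2 x0)).

Lemma hclass_surj X n (h : homology X n) : exists x (x0 : cyc x), h = hclass x0.
Proof.
rewrite -[h]quot_reprK; case: (quot_repr h) => x x0.
by exists x, ((cycP x).1 x0); congr quot_pi; apply: val_inj.
Qed.

Lemma hclass_eq X n (x y : X n) (x0 : cyc x) (y0 : cyc y) :
  hclass x0 = hclass y0 <-> bd (x - y).
Proof.
rewrite bdP; split=> [/quot_piP/im_predP[z zE]|[z zE]]; first by exists z.
by apply/quot_piP/im_predP; exists z.
Qed.

Lemma hclass_eq0 X n (x : X n) (x0 : cyc x) : hclass x0 = 0 <-> bd x.
Proof.
rewrite bdP; split=> [/quot_pi_eq0/im_predP[z zE]|[z zE]]; first by exists z.
by apply/quot_pi_eq0/im_predP; exists z.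
Qed.

Lemma hclassP X n c (x y : X n) (x0 : cyc x) (y0 : cyc y) :
  c *: hclass x0 + hclass y0 = hclass (cycD c x0 y0).
Proof.
rewrite [c *: hclass x0]quot_piZ -quot_piD; congr quot_pi.
exact: val_inj.
Qed.

Lemma is_zero_homology X n : is_zero (homology X n) <-> exact_at X n.
Proof.
split=> [H0 x x0|ex h]; first exact/(hclass_eq0 x0)/H0.
by have [x [x0 ->]] := hclass_surj h; apply/hclass_eq0/ex.
Qed.

(** Stated for relations between chains, since in the uses below the correspondence is often
    determined only up to boundaries. The last hypothesis makes it both well defined and injective
    on classes. *)
Lemma homology_iso X Y m n (G : X m -> Y n -> Prop) :
    linear_rel G ->
    (forall x, cyc x -> exists2 y, cyc y & G x y) ->
    (forall y, cyc y -> exists2 x, cyc x & G x y) ->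
    (forall x y, cyc x -> cyc y -> G x y -> (bd x <-> bd y)) ->
  lmod_iso (homology X m) (homology Y n).
Proof.
move=> [G0 GD] Gt Gs Gb.
pose H h k := exists x y (x0 : cyc x) (y0 : cyc y),
  [/\ h = hclass x0, k = hclass y0 & G x y].
have [|||g Hg] := @linear_rel_fun R (homology X m) (homology Y n) H.
- split.
    exists 0, 0, (@cyc0 X m), (@cyc0 Y n).
    by split=> //; apply/esym/hclass_eq0/bd0.
  move=> c _ _ _ _ [x [y [x0 [y0 [-> -> Gxy]]]]] [x' [y' [x0' [y0' [-> -> Gxy']]]]].
  exists (c *: x + x'), (c *: y + y'), (cycD c x0 x0'), (cycD c y0 y0').
  by rewrite !hclassP; split=> //; apply: GD.
- move=> k [x [y [x0 [y0 [/esym/hclass_eq0 xb -> Gxy]]]]].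
  by apply/hclass_eq0/(Gb x y).
- move=> h; have [x [x0 ->]] := hclass_surj h.
  have [y y0 Gxy] := Gt x x0.
  by exists (hclass y0), x, y, x0, y0.
exists g; apply: linear_bijective.
  move=> h gh; have [x [y [x0 [y0 [hE kE Gxy]]]]] := Hg h.
  rewrite hE; apply/hclass_eq0/(Gb x y) => //.
  by apply/(hclass_eq0 y0); rewrite -kE.
move=> k; have [y [y0 ->]] := hclass_surj k.
have [x x0 Gxy] := Gs y y0; exists (hclass x0).
have [x' [y' [x0' [y0' [/hclass_eq xx' -> Gxy']]]]] := Hg (hclass x0).
apply/esym/hclass_eq; apply/(Gb (x - x') (y - y')) => //.
- exact: cyc_sub.
- exact: cyc_sub.
by have := GD (-1) _ _ _ _ Gxy' Gxy; rewrite !scaleN1r ![- _ + _]addrC.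
Qed.

(** [homology_map] acts on a chosen representative; any other one differs from it by a boundary,
    which [f] maps to a boundary. *)
Lemma homology_map_hclass X Y (f : chain_map X Y) n (x : X n) (x0 : cyc x)
    (fx0 : cyc (f n x)) :
  homology_map f (hclass x0) = hclass fx0.
Proof.
have [y [y0 E]] : exists (y : X n) (y0 : cyc y),
    quot_repr (hclass x0) = Submod ((cycP y).2 y0).
  case: (quot_repr _) => y y0; exists y, ((cycP y).1 y0).
  exact: val_inj.
rewrite /homology_map E.
have /hclass_eq/bdP[z zE] : hclass x0 = hclass y0 by rewrite [RHS]/hclass -E quot_reprK.
apply/quot_piP/im_predP; exists (f _ (- z)) => /=.
by rewrite chain_comm !linearN /= zE linearB opprB.
Qed.

Lemma chain_map_cyc X Y (f : chain_map X Y) n (x : X n) : cyc x -> cyc (f n x).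
Proof. by move=> x0 m; rewrite chain_comm x0 linear0. Qed.

Lemma chain_map_bd X Y (f : chain_map X Y) n (x : X n) : bd x -> bd (f n x).
Proof. by move=> [m [y <-]]; rewrite -chain_comm; apply: bd_diff. Qed.

Lemma quasi_isoP X Y (f : chain_map X Y) : quasi_iso f <->
  forall n, (forall z : Y n, cyc z -> exists2 x : X n, cyc x & bd (f n x - z)) /\
            (forall x : X n, cyc x -> bd (f n x) -> bd x).
Proof.
split=> [qf n|H n].
  have [g fg gf] := qf n; split=> [z z0|x x0 fxb].
    have [x [x0 xE]] := hclass_surj (g (hclass z0)); exists x => //.
    apply/(hclass_eq (chain_map_cyc f x0) z0).
    by rewrite -homology_map_hclass -xE gf.
  apply/(hclass_eq0 x0); apply: (can_inj fg).
  rewrite (homology_map_hclass x0 (chain_map_cyc f x0)).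
  rewrite [LHS](_ : _ = 0); last exact/hclass_eq0.
  rewrite (_ : 0 = hclass (@cyc0 X n)); last exact/esym/hclass_eq0/bd0.
  rewrite (homology_map_hclass _ (chain_map_cyc f (@cyc0 X n))).
  by apply/esym/hclass_eq0; rewrite linear0; apply: bd0.
have [Hs Hi] := H n.
have /choice[g gE] (k : homology Y n) : exists h, homology_map f h = k.
  have [z [z0 ->]] := hclass_surj k; have [x x0 xz] := Hs z z0.
  by exists (hclass x0); rewrite (homology_map_hclass _ (chain_map_cyc f x0));
    apply/hclass_eq.
exists g => // h.
have [x [x0 ->]] := hclass_surj h.
have := gE (homology_map f (hclass x0)).
have [y [y0 ->]] := hclass_surj (g (homology_map f (hclass x0))).
rewrite (homology_map_hclass y0 (chain_map_cyc f y0)).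
rewrite (homology_map_hclass x0 (chain_map_cyc f x0)) => /hclass_eq.
by rewrite -linearB => /Hi xy; apply/hclass_eq/xy/cyc_sub.
Qed.

End HomologyElements.

(** Brings maps along a degree shift [g] into the format of [diff], indexed by arbitrary pairs of
    degrees. *)
Lemma extend_family (R : pzRingType) (A B : int -> lmodType R) (g : int -> int)
    (psi : forall i, {linear A i -> B (g i)}) :
  exists phi : forall i j, {linear A i -> B j},
    (forall i x, phi i (g i) x = psi i x) /\
    (forall i j x, j != g i -> phi i j x = 0).
Proof.
exists (fun i =>
  @eqtype.dfwith _ (fun j => {linear A i -> B j}) (fun=> \0%R) (g i) (psi i)).
split=> [i x|i j x ji]; first by rewrite dfwith_in.
by rewrite dfwith_out// eq_sym.
Qed.

(** Dependent choice going down from degree [N]; [d] fills the degrees from [N] upwards. *)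
Lemma descending_choice (T : int -> Type) (P : forall j, T j -> Prop)
    (Q : forall i j, T i -> T j -> Prop) (N : int) (d : forall j, T j) :
    P N (d N) ->
    (forall (j : int) x, j <= N -> P j x ->
      exists y, P (j - 1) y /\ Q j (j - 1) x y) ->
  exists F : forall j, T j,
    (forall j : int, N <= j -> F j = d j) /\
    (forall j : int, j <= N -> P j (F j) /\ Q j (j - 1) (F j) (F (j - 1))).
Proof.
move=> PN step.
(* Step [k] alters the family in degree [N - k - 1] only, so after [k] steps the degrees from
   [N - k] upwards are final. *)
pose good k (F F' : forall j, T j) :=
  (forall j : int, j != N - k%:Z - 1 -> F' j = F j) /\
  (P (N - k%:Z) (F (N - k%:Z)) ->
    P (N - k%:Z - 1) (F' (N - k%:Z - 1)) /\
    Q (N - k%:Z) (N - k%:Z - 1) (F (N - k%:Z)) (F' (N - k%:Z - 1))).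
have /choice[S SE] (kF : nat * (forall j, T j)) : exists F', good kF.1 kF.2 F'.
  case: kF => k F /=; case: (pselect (P (N - k%:Z) (F (N - k%:Z)))) => [PF|nPF].
    have [|y Hy] := step (N - k%:Z) (F (N - k%:Z)) _ PF; first lia.
    exists (@eqtype.dfwith _ _ F (N - k%:Z - 1) y).
    split=> [j jE|_]; first by rewrite dfwith_out// eq_sym.
    by rewrite dfwith_in.
  by exists F; split.
pose fix W k := if k is k'.+1 then S (k', W k') else d.
have WE k : good k (W k) (W k.+1) := SE (k, W k).
have Wd k (j : int) : N <= j -> W k j = d j.
  move=> Nj; elim: k => [//|k IHk].
  by rewrite (WE k).1//; lia.
have Wk k m : W (m + k)%N (N - k%:Z) = W k (N - k%:Z).
  by elim: m => [//|m IHm]; rewrite addSn (WE _).1//; lia.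
have PW k : P (N - k%:Z) (W k (N - k%:Z)).
  elim: k => [|k /(WE k).2[]]; first by rewrite subr0.
  by have -> : N - k.+1%:Z = N - k%:Z - 1 by lia.
exists (fun j => W `|N - j|%N j); split=> [j Nj|j jN]; first exact: Wd.
have -> : j = N - `|N - j|%N%:Z by lia.
move: `|N - j|%N => k.
have -> : `|(N - (N - k%:Z))%R|%N = k by lia.
have -> : `|(N - (N - k%:Z - 1))%R|%N = k.+1 by lia.
by split; [apply: PW|case: ((WE k).2 (PW k))].
Qed.

(** * Existence of injective resolutions *)

Lemma quot_pi_linear (R : pzRingType) (V : lmodType R) (S : submodClosed V) :
  linear (quot_pi S).
Proof. by move=> a x y; rewrite quot_piD -[in LHS]quot_piZ. Qed.

Section ResolutionExistence.
Variable R : comPzRingType.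

Definition zero_module : lmodType R := 'M[R]_(0, 0).

Lemma zero_moduleE (x y : zero_module) : x = y.
Proof. by rewrite [x]thinmx0 [y]thinmx0. Qed.

Lemma zero_module_extendable : rel_extendable zero_module.
Proof. by move=> A G _ _; exists \0%R => a b _; apply: zero_moduleE. Qed.

(* One degree of a partial resolution of a complex: the image of the incoming
   differential is recorded, but not its source. *)
Record res_stage (A : lmodType R) := ResStage {
  stage_obj : lmodType R;
  stage_map : {linear A -> stage_obj};
  stage_im : submodClosed stage_obj }.

Variable X : complex R.

(** The invariant of the recursion: since [stage_im] plays the role of the boundaries, the second
    condition says that the map is injective on homology. *)
Definition stage_ok n (s : res_stage (X n)) : Prop :=
  rel_extendable (stage_obj s) /\
  forall x : X n, cyc x -> stage_map s x \in stage_im s -> bd x.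

(** The second condition yields surjectivity on homology in the degree of [s]; the last one says
    that the recorded image is the image of the new differential. *)
Definition stage_diff i j (s : res_stage (X i)) (t : res_stage (X j))
    (f : stage_obj s -> stage_obj t) : Prop :=
  [/\ forall x, f (stage_map s x) = stage_map t (diff X i j x),
      forall e, f e = 0 -> exists2 x, cyc x & e - stage_map s x \in stage_im s,
      forall e, e \in stage_im s -> f e = 0
    & forall y, y \in stage_im t <-> exists e, f e = y].

(* The next module is an injective module containing the pushout of the
   cokernel of the incoming differential and [X (n - 1)] along [X n]. *)
Lemma stage_step n (s : res_stage (X n)) : stage_ok s ->
  exists t : res_stage (X (n - 1)), stage_ok t /\
    exists f : {linear stage_obj s -> stage_obj t}, stage_diff f.
Proof.
case: s => E f I [/= _ inj_f].
(* The relations that define the pushout as a quotient of [E * X (n - 1)]. *)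
pose P (v : (E * X (n - 1))%type) := exists2 w, w \in I &
  exists x : X n, v = (f x + w, - diff X n (n - 1) x).
have P0 : P 0.
  by exists 0; [exact: rpred0|exists 0]; rewrite !linear0 addr0 ?oppr0.
have PD c u v : P u -> P v -> P (c *: u + v).
  move=> [w wI [x ->]] [w' wI' [x' ->]].
  exists (c *: w + w'); first by apply: rpredD => //; apply: rpredZ.
  exists (c *: x + x'); rewrite !linearP; congr (_, _) => /=.
  by rewrite scalerDr addrACA.
pose S := pack_submod P0 PD.
have [E' [iota [extE' inj_iota]]] := enough_injectives (quotmod S).
have lin_d : linear (fun e : E => iota (quot_pi S (e, 0))).
  move=> c x y; rewrite -(linearP iota) -quot_pi_linear; congr (iota (quot_pi S _)).
  by congr (_, _); rewrite /= scaler0 addr0.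
have lin_f' : linear (fun x : X (n - 1) => iota (quot_pi S (0, x))).
  move=> c x y; rewrite -(linearP iota) -quot_pi_linear; congr (iota (quot_pi S _)).
  by congr (_, _); rewrite /= scaler0 addr0.
pose d := pack_linear lin_d; pose f' := pack_linear lin_f'.
have J0 : exists e, d e = 0 by exists 0; rewrite linear0.
have JD c x y : (exists e, d e = x) -> (exists e, d e = y) ->
    exists e, d e = c *: x + y.
  by move=> [e <-] [e' <-]; exists (c *: e + e'); rewrite linearP.
exists (@ResStage _ E' f' (pack_submod J0 JD)); split.
  split=> //= x x0 /(pack_submodP J0 JD)[e de].
  have /inj_iota/eqP : iota (quot_pi S (0, x) - quot_pi S (e, 0)) = 0.
    by rewrite linearB; apply/eqP; rewrite subr_eq0; apply/eqP/esym.
  rewrite subr_eq0 => /eqP/quot_piP/(pack_submodP P0 PD)[w _ [y [_]]].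
  by rewrite subr0 => ->; apply/bd_opp/bd_diff.
exists d; split=> /=.
- move=> x; rewrite /pack_linear_fun; apply: (congr1 iota).
  apply/quot_piP/(pack_submodP P0 PD).
  by exists 0; [exact: rpred0|exists x]; congr (_, _); rewrite /= ?subr0 ?addr0 ?sub0r.
- move=> e /inj_iota/quot_pi_eq0/(pack_submodP P0 PD)[w wI [x [eE /esym/eqP]]].
  rewrite oppr_eq0 => /eqP x0; exists x; first by apply/cycP; rewrite inE x0.
  by rewrite eE [_ + w]addrC addrK.
- move=> e eI; rewrite -(linear0 iota); apply: (congr1 iota).
  apply/quot_pi_eq0/(pack_submodP P0 PD); exists e => //; exists 0.
  by rewrite !linear0 add0r ?oppr0.
- by move=> y; apply: pack_submodP.
Qed.

Lemma injective_resolution_exists :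
  homology_bounded_above X -> exists E, is_injective_resolution X E.
Proof.
move=> [N XN].
(* In degree [N + 1] the complex [X] is exact, so the zero module satisfies [stage_ok] there and the
   recursion can start. *)
pose M := N + 1.
pose whole : submodClosed zero_module :=
  pack_submod (P := fun=> True) I (fun _ _ _ _ _ => I).
pose z n : res_stage (X n) := @ResStage _ zero_module \0%R whole.
have [||F [FM Fok]] := @descending_choice (fun n => res_stage (X n)) stage_ok
  (fun i j s t => exists f : {linear stage_obj s -> stage_obj t}, stage_diff f)
  M z.
- split=> [|x x0 _]; first exact: zero_module_extendable.
  have /is_zero_homology : is_zero (homology X M) by apply: XN; rewrite /M; lia.
  exact.
- by move=> j s _; apply: stage_step.
have FM0 n : M <= n -> forall e e' : stage_obj (F n), e = e'.
  by move=> /FM ->; apply: zero_moduleE.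
have ext n : rel_extendable (stage_obj (F n)).
  have [/Fok[[]]//|/ltW/FM ->] := leP n M; exact: zero_module_extendable.
have ex_d n : exists f : {linear stage_obj (F n) -> stage_obj (F (n - 1))},
    n <= M -> stage_diff f.
  have [/Fok[_ [f]]|] := leP n M; first by exists f.
  by exists \0%R.
pose d n := projT1 (cid (ex_d n)).
have dP n : n <= M -> stage_diff (d n) := projT2 (cid (ex_d n)).
have [phi [phiE phi0]]  :=
  @extend_family R _ (fun n => stage_obj (F n)) (fun n => n - 1) d.
have phiP i j : i = j + 1 -> i <= M -> stage_diff (phi i j).
  move=> iE iM; have jE : j = i - 1 by lia.
  subst j; have [d1 d2 d3 d4] := dP i iM.
  split=> [x|e|e|y]; rewrite ?phiE//.
  - exact: d2.
  - exact: d3.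
  - by rewrite d4; split=> -[e eE]; exists e; rewrite ?phiE// -phiE.
have phi_shape i j : i != j + 1 -> forall x, phi i j x = 0.
  by move=> ij x; apply: phi0; lia.
have phi_phi i j k x : phi j k (phi i j x) = 0.
  have [ij|ij] := eqVneq i (j + 1); last by rewrite (phi_shape i j ij) linear0.
  have [jk|jk] := eqVneq j (k + 1); last exact: phi_shape.
  have [iM|iM] := leP i M; last by rewrite (FM0 i _ x 0) ?linear0//; lia.
  have [_ _ _ P4] := phiP i j ij iM; have [_ _ P3 _] := phiP j k jk ltac:(lia).
  by apply/P3/P4; exists x.
pose E := Complex phi_shape phi_phi.
have comm i j x : diff E i j (stage_map (F i) x) = stage_map (F j) (diff X i j x).
  rewrite /=; have [ij|ij] := eqVneq i (j + 1); last first.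
    by rewrite phi_shape// diff_shape// linear0.
  have [iM|iM] := leP i M; first by have [+ _ _ _] := phiP i j ij iM.
  by apply: FM0; lia.
pose f := @ChainMap R X E (fun n => stage_map (F n)) comm.
exists E; split.
- by exists M => n Mn x; apply: FM0; lia.
- by move=> n; apply: rel_extendable_injective; apply: ext.
exists f; apply/quasi_isoP => n.
have [Mn|nM] := leP M n.
  split=> [y y0|x x0 _].
    by exists 0; [exact: cyc0|rewrite [_ - _](FM0 n Mn _ 0); apply: bd0].
  have /is_zero_homology : is_zero (homology X n) by apply: XN; rewrite /M in Mn; lia.
  exact.
have [_ P2 _ _] := phiP n (n - 1) ltac:(lia) (ltW nM).
have [_ _ _ P4] := phiP (n + 1) n erefl ltac:(lia).
split=> [y y0|x x0 /bdP/P4 fx].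
  have [x x0 /P4 xy] := P2 y (y0 _); exists x => //.
  by rewrite -opprB; apply/bd_opp/bdP.
by have [_ ] := (Fok n (ltW nM)).1; apply.
Qed.

End ResolutionExistence.

(** * Torsion submodules of injective modules *)

Lemma injective_resolutionP (R : comPzRingType) (X : complex R) :
  homology_bounded_above X -> is_injective_resolution X (injective_resolution X).
Proof.
move=> /injective_resolution_exists ex; rewrite /injective_resolution.
by case: pselect => // ex'; case: (cid ex').
Qed.

Lemma linear_rel_sum (R : pzRingType) (A B : lmodType R) (G : A -> B -> Prop)
    n (c : 'I_n -> R) a b :
  linear_rel G -> (forall i, G (a i) (b i)) ->
  G (\sum_i c i *: a i) (\sum_i c i *: b i).
Proof.
move=> [G0 GD] Gab; elim: n c a b Gab => [|n IHn] c a b Gab; first by rewrite !big_ord0.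
by rewrite !big_ord_recl; apply: GD => //; apply: IHn.
Qed.

Section TorsionInjective.
Variables (R : comPzRingType) (noethR : noetherian R) (b : ideal R).

Lemma expr_ideal_exp x n : x \in b -> x ^+ n \in ideal_exp b n.
Proof.
move=> xb; elim: n => [//|n IHn].
apply/ideal_mul_predP; exists 1, (fun=> x), (fun=> x ^+ n).
by rewrite big_ord1 -exprS.
Qed.

Lemma ideal_exp_sum_sub n (t : 'I_n -> nat) i x :
  x \in ideal_exp b (\sum_j t j) -> x \in ideal_exp b (t i).
Proof. by rewrite (bigD1 i)//= addnC; apply: ideal_exp_sub. Qed.

Lemma torsion_exponent (M : lmodType R) n (y : 'I_n -> M) :
    (forall i, y i \in @torsion_pred R b M) ->
  exists t, forall i x, x \in ideal_exp b t -> x *: y i = 0.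
Proof.
move=> yT.
have /choice[t tP] i : exists t, forall x, x \in ideal_exp b t -> x *: y i = 0.
  by have /torsion_predP := yT i.
by exists (\sum_j t j)%N => i x xt; apply: tP; apply: ideal_exp_sum_sub xt.
Qed.

Lemma noetherian_generators (P : R -> Prop) (P0 : P 0)
    (PD : forall c x y, P x -> P y -> P (c * x + y)) :
  exists (n : nat) (g : 'I_n -> R),
  (forall i, P (g i)) /\ forall x, P x -> exists c, x = \sum_i c i * g i.
Proof.
have [n [g gP]] := noethR (@pack_submod R R^o P P0 PD); exists n, g.
split=> [i|x Px]; last exact/gP/(pack_submodP (V := R^o) P0 PD).
apply/(pack_submodP (V := R^o) P0 PD)/gP.
exists (fun j => (j == i)%:R); rewrite (bigD1 i)//= eqxx mul1r.
by rewrite big1 ?addr0// => j /negPf ->; rewrite mul0r.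
Qed.

Section IdealOfProp.
Variable P : R -> Prop.
Hypotheses (P0 : P 0) (PD : forall c x y, P x -> P y -> P (c * x + y)).

Lemma ideal_propM c x : P x -> P (c * x).
Proof. by move=> Px; rewrite -[_ * _]addr0; apply: PD. Qed.

Lemma ideal_prop_sum n (c g : 'I_n -> R) :
  (forall i, P (g i)) -> P (\sum_i c i * g i).
Proof.
elim: n c g => [|n IHn] c g gP; first by rewrite big_ord0.
by rewrite big_ord_recl; apply: PD => //; apply: IHn.
Qed.

(** The colon ideals of [P] by the powers of [x] increase; their union is finitely generated, so it
    is reached by an exponent that serves all the generators. *)
Lemma colon_stable x : exists k, forall m c, P (x ^+ m * c) -> P (x ^+ k * c).
Proof.
have mono m n c : P (x ^+ m * c) -> P (x ^+ (n + m) * c).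
  by move=> Pm; rewrite exprD -mulrA; apply: ideal_propM.
pose Q c := exists m, P (x ^+ m * c).
have Q0 : Q 0 by exists 0%N; rewrite mulr0.
have QD c y z : Q y -> Q z -> Q (c * y + z).
  move=> [m Pm] [n Pn]; exists (n + m)%N; rewrite mulrDr mulrCA.
  by apply: PD; [apply: mono|rewrite addnC; apply: mono].
have [n [g [/choice[t gP] gen]]] := noetherian_generators Q0 QD.
exists (\sum_j t j)%N => m c Pm.
have [d ->] : exists d, c = \sum_i d i * g i by apply: gen; exists m.
rewrite mulr_sumr (eq_bigr (fun i => d i * (x ^+ (\sum_j t j) * g i))).
  by apply: ideal_prop_sum => i; rewrite (bigD1 i)//= addnC; apply: mono.
by move=> i _; rewrite mulrCA.
Qed.

(** Induction on [s]: the [r] found for the tail is multiplied by the highest power of [x] that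
    keeps it outside [P]. *)
Lemma colon_proper (s : seq R) : ~ P 1 -> {in s, forall x, exists k, P (x ^+ k)} ->
  exists2 r, ~ P r & {in s, forall x, P (x * r)}.
Proof.
move=> P1; elim: s => [|x s IHs] sP; first by exists 1.
have [|r Pr rs] := IHs; first by move=> y ys; apply: sP; rewrite inE ys orbT.
have ex : exists k, `[< P (x ^+ k * r) >].
  have [|k Pk] := sP x; first by rewrite inE eqxx.
  by exists k; apply/asboolP; rewrite mulrC; apply: ideal_propM.
case: (ex_minnP ex) => -[|k] /asboolP Pk kmin.
  by case: Pr; move: Pk; rewrite mul1r.
exists (x ^+ k * r); first by move=> /asboolT/kmin; rewrite ltnn.
move=> y; rewrite inE => /predU1P[->|ys]; first by rewrite mulrA -exprS.
by rewrite mulrCA; apply: ideal_propM; apply: rs.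
Qed.

End IdealOfProp.

Lemma ideal_generators (I : ideal R) : exists (n : nat) (g : 'I_n -> R),
  (forall i, g i \in I) /\ forall x, x \in I -> exists c, x = \sum_i c i * g i.
Proof.
apply: (noetherian_generators (P := fun x => x \in I)); first exact: (rpred0 I).
by move=> c x y xI yI; apply: (rpredD (S := I)) => //; apply: (rpredZ (s := I)).
Qed.

(* No Artin-Rees: a map on a proper ideal [I] extends by zero to a high power of
   some [x] in [b] if no power of [x] lies in [I]; otherwise [b] is nilpotent
   modulo [I], so [b r] lies in [I] for some [r] outside [I], and the values at
   [r] of extensions to [E] are torsion. *)
Lemma torsion_extendable (E : lmodType R) :
  rel_extendable E -> rel_extendable (torsion b E).
Proof.
move=> extE; apply: one_step_extendable => G Gl Gf n1.
pose P (c : R) := exists y, G c y.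
have P0 : P 0 by exists 0; case: Gl.
have PD c x y : P x -> P y -> P (c * x + y).
  by move=> [z Gz] [w Gw]; exists (c *: z + w); apply: Gl.2 c x z y w Gz Gw.
have GZ (c x : R) y : G x y -> G (c * x) (c *: y).
  by move=> Gxy; have := Gl.2 c x y 0 0 Gxy Gl.1; rewrite !addr0.
have [[x [xb xP]]|nx] := pselect (exists x, x \in b /\ forall k, ~ P (x ^+ k)).
  (* The domain is finitely generated and the values are torsion, so one power of [x] kills all
     values. *)
  have [k kP] : exists k, forall c y, G c y -> x ^+ k *: y = 0.
    have [n [g [gP gen]]] := noetherian_generators P0 PD.
    have [y gy] := choice gP.
    have [t tP] := @torsion_exponent _ _ (fun i => val (y i)) (fun i => valP (y i)).
    exists t => c z Gcz; have [d dE] : exists d, c = \sum_i d i * g i.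
      by apply: gen; exists z.
    have Gd := linear_rel_sum d Gl gy.
    have -> : z = \sum_i d i *: y i.
      by apply: (linear_rel_uniq Gl Gf _ Gd); rewrite {1}dE in Gcz.
    rewrite scaler_sumr big1// => i _; apply: val_inj => /=.
    by rewrite scalerA mulrC -scalerA tP ?scaler0//; apply: expr_ideal_exp.
  have [k' kP'] := colon_stable P0 PD x.
  (* If [c * x ^+ (k + k')] is in the domain, so is [x ^+ k' * c], and the remaining factor [x ^+ k]
     kills its value. *)
  exists (x ^+ (k + k')), 0; split; first exact: xP.
  move=> c y Gcy; rewrite scaler0.
  have [z Gz] : P (x ^+ k' * c).
    by apply: (kP' (k + k')%N); exists y; rewrite mulrC.
  apply: (linear_rel_uniq Gl Gf Gcy); rewrite -(kP _ _ Gz).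
  by rewrite mulrC exprD -mulrA; apply: GZ.
have [n [g [gb gen]]] := ideal_generators b.
have [|r nr rP] := colon_proper P0 PD n1 (s := codom g).
  move=> _ /codomP[i ->]; apply: contrapT => ng; apply: nx.
  by exists (g i); split=> // k Pk; apply: ng; exists k.
have [||h hE] := extE R^o (fun c y => exists2 z, G c z & val z = y).
- split=> [|c x _ x' _ [z Gz <-] [z' Gz' <-]]; first by exists 0 => //; case: Gl.
  by exists (c *: z + z') => //; apply: Gl.2.
- by move=> _ [z /Gf -> <-].
have hZ (c x : R) : h (c * x) = c *: h x by rewrite -linearZ.
have rT : h r \in @torsion_pred R b E.
  have hT i : h (g i * r) \in @torsion_pred R b E.
    have [z Gz] := rP _ (codom_f g i).
    by rewrite (hE _ (val z)) ?(valP z)//; exists z.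
  have [t tP] := torsion_exponent hT.
  (* One factor from [b] moves [r] into the domain; the other [t] factors kill the values at the
     finitely many [g i * r]. *)
  apply/torsion_predP; exists t.+1 => x /ideal_mul_predP[m [f [f' [fb f'b ->]]]].
  rewrite scaler_suml big1// => j _.
  have [c ->] := gen _ (fb j).
  rewrite mulr_suml scaler_suml big1// => i _.
  by rewrite -mulrA -scalerA [g i * _]mulrC -scalerA -hZ tP ?scaler0.
exists r, (Submod rT); split=> // c y Gcy; apply: val_inj => /=.
by rewrite -hZ; apply/esym/hE; exists y.
Qed.

End TorsionInjective.

(** * Splitting and mapping cones *)

Lemma cyc_at (R : pzRingType) (X : complex R) n m (x : X n) :
  n = m + 1 -> diff X n m x = 0 -> cyc x.
Proof.
move=> nm x0 k; have [->//|km] := eqVneq k m.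
by apply: diff_shape; lia.
Qed.

Lemma bd_at (R : pzRingType) (X : complex R) n m (x : X n) :
  bd x -> m = n + 1 -> exists y, diff X m n y = x.
Proof. by move=> /bdP + ->. Qed.

Definition bounded_above (R : pzRingType) (X : complex R) : Prop :=
  exists N : int, forall n : int, N < n -> is_zero (X n).

Definition injective_complex (R : pzRingType) (X : complex R) : Prop :=
  bounded_above X /\ forall n, rel_extendable (X n).

Section Contraction.
Variables (R : pzRingType) (J : complex R) (n : int).
Hypotheses (injJ : injective_complex J) (exJ : forall k, n < k -> exact_at J k).

(** Downward induction on the degree, from the range where [J] vanishes: the boundaries split off
    because [J] is injective, and exactness is needed only above degree [n]. *)
Lemma top_contraction k : n <= k -> exists h : {linear J k -> J (k + 1)},
  forall x, diff J (k + 1) k (h (diff J (k + 1) k x)) = diff J (k + 1) k x.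
Proof.
have [[N JN] extJ] := injJ.
suff H (m : nat) : forall k, n <= k -> N - m%:Z <= k ->
    exists h : {linear J k -> J (k + 1)},
    forall x, diff J (k + 1) k (h (diff J (k + 1) k x)) = diff J (k + 1) k x.
  by move=> nk; apply: (H `|N - k|%N); lia.
elim: m => [|m IHm] {}k nk mk.
  exists \0%R => x; rewrite [x](_ : _ = 0) ?linear0//.
  by apply: JN; lia.
have [||h' h'E] := IHm (k + 1); [lia|lia|].
pose d := diff J (k + 1) k; pose d' := diff J (k + 1 + 1) (k + 1).
(* The assignment [d x |-> x - d' (h' x)] is well defined: if [d x = 0], then [x] is a boundary by
   exactness in degree [k + 1], and [d' h'] fixes boundaries. *)
have [||h hE] := extJ (k + 1) (J k)
  (fun y z => exists2 x, y = d x & z = x - d' (h' x)).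
- split=> [|c _ _ _ _ [x -> ->] [y -> ->]].
    by exists 0; rewrite !linear0 ?addr0.
  exists (c *: x + y); first by rewrite linearP.
  by rewrite (linearP h') (linearP d') scalerBr opprD addrACA.
- move=> z [x dx ->].
  have /bdP[u <-] : bd x by apply: exJ; [lia|exact: (cyc_at (m := k))].
  by rewrite [d' _]h'E subrr.
exists h => x; rewrite (hE _ (x - d' (h' x))); last by exists x.
by rewrite linearB /= [diff _ _ _ (d' _)]diff_diff subr0.
Qed.

Lemma top_splitting k : n < k -> exists h : {linear J k -> J (k + 1)},
  forall x, cyc x -> diff J (k + 1) k (h x) = x.
Proof.
move=> nk; have [|h hE] := @top_contraction k; first lia.
by exists h => x /(exJ nk)/bdP[y <-].
Qed.

End Contraction.

Section FunctorCycles.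
Variable R : comPzRingType.

Lemma cyc_hom (N : lmodType R) (X : complex R) n (u : hom_complex N X n) :
  cyc u <-> forall y, cyc (val u y).
Proof.
split=> [u0 y m|u0 m]; first by have /(congr1 (fun v => val v y)) := u0 m.
by apply/val_inj/funext => y; apply: u0.
Qed.

(** A linear section of the differential survives any additive functor, exact or not;
    [torsion_exact] rests on the same point. *)
Lemma hom_exact (N : lmodType R) (J : complex R) n : injective_complex J ->
  (forall k, n < k -> exact_at J k) -> forall k, n < k -> exact_at (hom_complex N J) k.
Proof.
move=> injJ exJ k nk; have [h hE] := top_splitting injJ exJ nk.
move=> u /cyc_hom u0; exists (k + 1), (hom_map N h u).
by apply/val_inj/funext => y; apply: hE.
Qed.

Lemma cyc_torsion (b : ideal R) (X : complex R) n (x : torsion_complex b X n) :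
  cyc x <-> @cyc R X n (val x).
Proof.
split=> [x0 m|x0 m]; first by have /(congr1 val) := x0 m.
by apply/val_inj/x0.
Qed.

Lemma torsion_exact (b : ideal R) (J : complex R) n : injective_complex J ->
  (forall k, n < k -> exact_at J k) ->
  forall k, n < k -> exact_at (torsion_complex b J) k.
Proof.
move=> injJ exJ k nk; have [h hE] := top_splitting injJ exJ nk.
move=> x /cyc_torsion x0; exists (k + 1), (torsion_map b h x).
by apply/val_inj/hE.
Qed.

End FunctorCycles.

(* [C] is the mapping cone of [phi], a chain map from [K], shifted by [c - 1],
   to [A]; only the coordinates [r] and [p] of its elements are given, so that
   additive functors visibly preserve cones. *)
Definition is_cone (R : pzRingType) (A K C : complex R) (c : int)
    (phi : forall i j, {linear K i -> A j})
    (r : forall k, {linear C k -> A k}) (p : forall k, {linear C k -> K (k - c)}) :=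
  [/\ forall k a y, exists2 x, r k x = a & p k x = y,
      forall k x, r k x = 0 -> p k x = 0 -> x = 0,
      forall i j x, r j (diff C i j x) = diff A i j (r i x) + phi (i - c) j (p i x)
    & forall i j x, p j (diff C i j x) = - diff K (i - c) (j - c) (p i x)].

(** * Homology of a mapping cone *)

Section ConeHomology.
Variables (R : pzRingType) (A K C : complex R) (c : int).
Variable phi : forall i j, {linear K i -> A j}.
Variables (r : forall k, {linear C k -> A k}) (p : forall k, {linear C k -> K (k - c)}).
Hypothesis coneP : is_cone phi r p.

Let pair k a y : exists2 x, r k x = a & p k x = y.
Proof. by case: coneP. Qed.

Let pair0 k (x : C k) : r k x = 0 -> p k x = 0 -> x = 0.
Proof. by case: coneP => _ + _ _; apply. Qed.

Let r_diff i j x : r j (diff C i j x) = diff A i j (r i x) + phi (i - c) j (p i x).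
Proof. by case: coneP. Qed.

Let p_diff i j x : p j (diff C i j x) = - diff K (i - c) (j - c) (p i x).
Proof. by case: coneP. Qed.

Let pair_eq k (x y : C k) : r k x = r k y -> p k x = p k y -> x = y.
Proof.
move=> rE pE; apply/eqP; rewrite -subr_eq0; apply/eqP/pair0.
  by rewrite linearB /= rE subrr.
by rewrite linearB /= pE subrr.
Qed.

(** That [phi] commutes with the differentials is read off from the square of the differential of
    [C], at an element with coordinates 0 and [y]. *)
Lemma cone_phi_diff i j k y :
  phi (j - c) k (diff K (i - c) (j - c) y) = diff A j k (phi (i - c) j y).
Proof.
have [x rx px] := pair (0 : A i) y.
have := r_diff k (diff C i j x).
rewrite diff_diff linear0 r_diff p_diff rx px linear0 add0r linearN.
by move/esym/eqP; rewrite subr_eq0 => /eqP.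
Qed.

Lemma cone_phi_cyc i j (y : K (i - c)) : cyc y -> cyc (phi (i - c) j y).
Proof. by move=> y0 k; rewrite -cone_phi_diff y0 linear0. Qed.

Lemma cone_phi_bd i j (y : K (i - c)) : bd y -> bd (phi (i - c) j y).
Proof.
move=> /bd_at-/(_ (i + 1 - c))[|z <-]; first lia.
by rewrite cone_phi_diff; apply: bd_diff.
Qed.

Lemma cone_p_cyc k (x : C k) : cyc x -> cyc (p k x).
Proof.
move=> x0; apply: (cyc_at (m := k - 1 - c)); first lia.
by apply/eqP; rewrite -oppr_eq0 -p_diff x0 linear0.
Qed.

Lemma cone_r_cyc k (x : C k) : cyc x -> p k x = 0 -> cyc (r k x).
Proof.
by move=> x0 px m; have := r_diff m x; rewrite x0 px !linear0 addr0 => <-.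
Qed.

Lemma cone_cyc k (x : C k) : cyc (r k x) -> p k x = 0 -> cyc x.
Proof.
move=> rx px m; apply: pair0; first by rewrite r_diff rx px linear0 addr0.
by rewrite p_diff px linear0 oppr0.
Qed.

Lemma cone_clear_p k (x : C k) : bd (p k x) ->
  exists x' : C (k + 1), p k (x + diff C (k + 1) k x') = 0.
Proof.
move=> /bd_at-/(_ (k + 1 - c))[|y yE]; first lia.
have [x' _ px'] := pair (0 : A (k + 1)) y.
by exists x'; rewrite linearD /= p_diff px' yE subrr.
Qed.

Lemma cone_bd k (x : C k) : bd (r k x) -> p k x = 0 -> bd x.
Proof.
move=> /bdP[a aE] px; have [w rw pw] := pair a (0 : K (k + 1 - c)).
apply/bdP; exists w; apply: pair_eq; first by rewrite r_diff rw pw linear0 addr0.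
by rewrite p_diff pw px linear0 oppr0.
Qed.

(** If [w] bounds [x], then [p w] is a cycle, hence a boundary, and [w] can be altered by a boundary
    so as to lie in [A]. *)
Lemma cone_r_bd k (x : C k) : exact_at K (k + 1 - c) ->
  bd x -> p k x = 0 -> bd (r k x).
Proof.
move=> exK /bdP[w <-] pw.
have [|w' pw'] := @cone_clear_p _ w.
  apply/exK/(cyc_at (m := k - c)); first lia.
  by apply/eqP; rewrite -oppr_eq0 -p_diff pw.
have -> : diff C (k + 1) k w = diff C (k + 1) k (w + diff C (k + 1 + 1) (k + 1) w').
  by rewrite linearD /= diff_diff addr0.
by rewrite r_diff pw' linear0 addr0; apply: bd_diff.
Qed.

(** This lemma and the next three are the parts of the long exact sequence of the cone that are
    used. The relation [G] says that [x] is homologous in [C] to the image of [a]. *)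
Lemma cone_homology_iso k : exact_at K (k + 1 - c) -> exact_at K (k - c) ->
  lmod_iso (homology A k) (homology C k).
Proof.
move=> exK1 exK.
pose G (a : A k) (x : C k) := exists x' : C (k + 1),
  r k (x + diff C (k + 1) k x') = a /\ p k (x + diff C (k + 1) k x') = 0.
apply: (homology_iso (G := G)).
- split=> [|e a x a' x' [w [<- pw]] [w' [<- pw']]].
    by exists 0; rewrite !linear0 addr0 !linear0.
  exists (e *: w + w').
  have -> : e *: x + x' + diff C (k + 1) k (e *: w + w') =
      e *: (x + diff C (k + 1) k w) + (x' + diff C (k + 1) k w').
    by rewrite linearP /= scalerDr addrACA.
  by rewrite !linearP /= pw pw' scaler0 addr0.
- move=> a a0; have [x rx px] := pair a (0 : K (k - c)).
  exists x; first by apply: cone_cyc; rewrite ?rx.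
  by exists 0; rewrite linear0 addr0.
- move=> x x0; have [x' px'] := cone_clear_p (exK _ (cone_p_cyc x0)).
  exists (r k (x + diff C (k + 1) k x')); last by exists x'.
  by apply: cone_r_cyc => //; apply: cyc_add => //; apply: cyc_diff.
- move=> a x a0 x0 [x' [<- px']]; split=> [/cone_bd|xb].
    by move=> /(_ px')/bd_sub-/(_ _ (bd_diff k x')); rewrite addrK.
  by apply: cone_r_bd => //; apply: bd_add => //; apply: bd_diff.
Qed.

Lemma cone_exact_base k : exact_at K (k + 1 - c) -> exact_at C k -> exact_at A k.
Proof.
move=> exK exC a a0; have [x rx px] := pair a (0 : K (k - c)).
rewrite -rx; apply: cone_r_bd => //; apply: exC.
by apply: cone_cyc; rewrite ?rx.
Qed.

Lemma cone_connecting_iso k : exact_at C (k + 1) -> exact_at C k ->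
  lmod_iso (homology K (k + 1 - c)) (homology A k).
Proof.
move=> exC1 exC.
apply: (homology_iso (G := fun y a => bd (a - phi (k + 1 - c) k y))).
- split=> [|e y a y' a' ya ya']; first by rewrite linear0 subr0; apply: bd0.
  have -> : e *: a + a' - phi (k + 1 - c) k (e *: y + y') =
      e *: (a - phi (k + 1 - c) k y) + (a' - phi (k + 1 - c) k y').
    by rewrite linearP /= scalerBr opprD addrACA.
  exact: bdD.
- move=> y y0; exists (phi (k + 1 - c) k y); first exact: cone_phi_cyc.
  by rewrite subrr; apply: bd0.
- move=> a a0; have [x rx px] := pair a (0 : K (k - c)).
  have /bdP[w wx] : bd x by apply: exC; apply: cone_cyc; rewrite ?rx.
  exists (p (k + 1) w).
    apply: (cyc_at (m := k - c)); first lia.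
    by apply/eqP; rewrite -oppr_eq0 -p_diff wx px.
  by rewrite -rx -wx r_diff addrK; apply: bd_diff.
move=> y a y0 a0 ya; split=> [/(@cone_phi_bd (k + 1) k)|ab].
  by move=> yb; rewrite -[a](subrK (phi (k + 1 - c) k y)); apply: bd_add.
have : bd (phi (k + 1 - c) k y).
  rewrite -[phi _ _ _](opprK) -[X in bd (- X)](addKr a).
  by apply: bd_opp; apply: bd_add => //; apply: bd_opp.
(* The element with coordinates [- a'] and [y] is a cycle; it bounds since [C] is exact in degree
   [k + 1], and so [y] bounds. *)
move=> /bdP[a' a'E]; have [x rx px] := pair (- a') y.
have /exC1/bdP[w wx] : cyc x.
  apply: (cyc_at (m := k)) => //; apply: pair0.
    by rewrite r_diff rx px linearN /= a'E addNr.
  by rewrite p_diff px y0 oppr0.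
by rewrite -px -wx p_diff; apply/bd_opp/bd_diff.
Qed.

(** Injectivity of [phi] on homology lets a cycle be moved to one with [p] equal to 0; by
    surjectivity its other coordinate is [phi y] plus a boundary of some [a'], and the pair of [a']
    and [y] bounds it. *)
Lemma cone_exact k :
  (forall a : A k, cyc a -> exists2 y, cyc y & bd (a - phi (k + 1 - c) k y)) ->
  (forall y : K (k - c), cyc y -> bd (phi (k - c) (k - 1) y) -> bd y) ->
  exact_at C k.
Proof.
move=> phi_surj phi_inj x x0.
have [|x' px'] := @cone_clear_p _ x.
  apply: phi_inj; first exact: cone_p_cyc.
  have -> : phi (k - c) (k - 1) (p k x) = - diff A k (k - 1) (r k x).
    apply/eqP; rewrite -subr_eq0 opprK [X in X == _]addrC -r_diff.
    by rewrite x0 linear0.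
  exact/bd_opp/bd_diff.
suff : bd (x + diff C (k + 1) k x').
  by move=> /bd_sub-/(_ _ (bd_diff k x')); rewrite addrK.
have [|y y0 /bdP[a' a'E]] := phi_surj (r k (x + diff C (k + 1) k x')).
  by apply: cone_r_cyc => //; apply: cyc_add => //; apply: cyc_diff.
have [w rw pw] := pair a' y; apply/bdP; exists w; apply: pair_eq.
  by rewrite r_diff rw pw a'E subrK.
by rewrite p_diff pw y0 px' oppr0.
Qed.

End ConeHomology.

Section HomCone.
Variable R : comPzRingType.

Definition hom_of_linear (N M : lmodType R) (g : {linear N -> M}) : hom_module N M :=
  Submod (introT (hom_predP (g : N -> M)) (linearP g)).

Lemma hom_linear (N M : lmodType R) (u : hom_module N M) : linear (val u).
Proof. exact/hom_predP/(valP u). Qed.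

(** The coordinates exhibit [C k] as a product, and Hom preserves products. *)
Lemma hom_cone (N : lmodType R) (A K C : complex R) c phi r p :
    @is_cone R A K C c phi r p ->
  @is_cone R (hom_complex N A) (hom_complex N K) (hom_complex N C) c
    (fun i j => hom_map N (phi i j)) (fun k => hom_map N (r k))
    (fun k => hom_map N (p k)).
Proof.
move=> [pair pair0 r_diff p_diff]; split.
- move=> k u v.
  have uL := hom_linear u; have vL := hom_linear v.
  have [|||w wE] := @linear_rel_fun R N (C k)
    (fun y x => r k x = val u y /\ p k x = val v y).
  + split=> [|a y x y' x' [rx px] [rx' px']].
      have u0 := linear0 (pack_linear uL); have v0 := linear0 (pack_linear vL).
      by split; rewrite linear0; symmetry; [exact: u0|exact: v0].
    by rewrite !linearP /= rx px rx' px' uL vL.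
  + move=> x [rx px]; apply: (pair0 k).
      by rewrite rx; exact: (linear0 (pack_linear uL)).
    by rewrite px; exact: (linear0 (pack_linear vL)).
  + by move=> y; have [x rx px] := pair k (val u y) (val v y); exists x.
  by exists (hom_of_linear w); apply/val_inj/funext => y; have [] := wE y.
- move=> k u ru pu; apply/val_inj/funext => y; apply: (pair0 k).
    by have := congr1 (fun v => val v y) ru.
  by have := congr1 (fun v => val v y) pu.
- by move=> i j u; apply/val_inj/funext => y; apply: r_diff.
- by move=> i j u; apply/val_inj/funext => y; apply: p_diff.
Qed.

End HomCone.

Lemma prod_extendable (R : pzRingType) (E F : lmodType R) :
  rel_extendable E -> rel_extendable F -> rel_extendable (E * F)%type.
Proof.
move=> extE extF A G [G0 GD] Gf.
have [||f fE] := extE A (fun a x => exists2 z, G a z & x = z.1).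
- split=> [|c a _ a' _ [z Gz ->] [z' Gz' ->]]; first by exists 0.
  by exists (c *: z + z') => //; apply: GD.
- by move=> x [z /Gf -> ->].
have [||g gE] := extF A (fun a x => exists2 z, G a z & x = z.2).
- split=> [|c a _ a' _ [z Gz ->] [z' Gz' ->]]; first by exists 0.
  by exists (c *: z + z') => //; apply: GD.
- by move=> x [z /Gf -> ->].
have lin_fg : linear (fun a => (f a, g a)).
  by move=> c x y; rewrite !linearP.
exists (pack_linear lin_fg) => a z Gaz.
change ((f a, g a) = z); rewrite (fE a z.1); last by exists z.
by rewrite (gE a z.2); [case: z {Gaz}|exists z].
Qed.

Section ConeConstruction.
Variables (R : pzRingType) (A K : complex R) (c : int).
Variable phi : forall i j, {linear K i -> A j}.
Hypothesis phi_shape : forall i j x, i + c != j + 1 -> phi i j x = 0.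
Hypothesis phi_comm : forall i j k y,
  phi (j - c) k (diff K (i - c) (j - c) y) = diff A j k (phi (i - c) j y).

Definition cone_obj k : lmodType R := (A k * K (k - c))%type.

Definition cone_diff_fun i j (x : cone_obj i) : cone_obj j :=
  (diff A i j x.1 + phi (i - c) j x.2, - diff K (i - c) (j - c) x.2).

Lemma cone_diff_linear i j : linear (@cone_diff_fun i j).
Proof.
move=> e x y; rewrite /cone_diff_fun !linearP; congr (_, _) => /=.
by rewrite scalerDr addrACA.
Qed.

Definition cone_diff i j : {linear cone_obj i -> cone_obj j} :=
  pack_linear (@cone_diff_linear i j).

Lemma cone_shape i j : i != j + 1 -> forall x, cone_diff i j x = 0.
Proof.
move=> ij x; change (cone_diff_fun j x = 0); rewrite /cone_diff_fun.
rewrite diff_shape// phi_shape ?diff_shape ?oppr0 ?addr0//; lia.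
Qed.

Lemma cone_diff_diff i j k x : cone_diff j k (cone_diff i j x) = 0.
Proof.
change (cone_diff_fun k (cone_diff_fun j x) = 0); rewrite /cone_diff_fun /=.
by rewrite !linearN /= linearD /= diff_diff phi_comm add0r subrr diff_diff !oppr0.
Qed.

Definition cone : complex R := Complex cone_shape cone_diff_diff.

Lemma coneP : @is_cone R A K cone c phi
  (fun k => fst : {linear (A k * K (k - c))%type -> A k})
  (fun k => snd : {linear (A k * K (k - c))%type -> K (k - c)}).
Proof.
split=> //; first by move=> k a y; exists (a, y).
by move=> k [x y] /= -> ->.
Qed.

Lemma cone_injective : injective_complex A -> injective_complex K ->
  injective_complex cone.
Proof.
move=> [[M AM] extA] [[N KN] extK]; split; last first.
  by move=> k; apply: prod_extendable.
exists (Order.max M (N + c)) => k kMN [x y].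
by rewrite (AM _ _ x) ?(KN _ _ y)//; lia.
Qed.

End ConeConstruction.

Section Stalk.
Variables (R : pzRingType) (M : lmodType R).

Lemma stalk_exact k : k != 0 -> exact_at (stalk M) k.
Proof.
move=> k0 x _; suff -> : x = 0 by apply: bd0.
move: x; rewrite /= /stalk_obj (negPf k0) => x.
by rewrite [x]thinmx0.
Qed.

Lemma stalk_bounded : homology_bounded_above (stalk M).
Proof. by exists 0 => k k0; apply/is_zero_homology/stalk_exact; lia. Qed.

Lemma stalk_homology0 : lmod_iso (homology (stalk M) 0) M.
Proof.
have all_cyc (x : stalk M 0) : cyc x by [].
have lin_f : linear (fun x : M => hclass (all_cyc x) : homology (stalk M) 0).
  by move=> c x y; rewrite hclassP; congr hclass.
apply: lmod_iso_sym; exists (pack_linear lin_f); apply: linear_bijective.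
  by move=> x /hclass_eq0[m [y <-]].
by move=> h; have [x [x0 ->]] := hclass_surj h; exists x; congr hclass.
Qed.

End Stalk.

Lemma quasi_iso_homology (R : pzRingType) (X Y : complex R) (f : chain_map X Y) n :
  quasi_iso f -> lmod_iso (homology X n) (homology Y n).
Proof.
move=> /quasi_isoP/(_ n)[Hs Hi].
apply: (homology_iso (G := fun x y => bd (f n x - y))).
- split=> [|c x y x' y' xy xy']; first by rewrite linear0 subr0; apply: bd0.
  by rewrite linearP opprD addrACA -scalerBr; apply: bdD.
- move=> x x0; exists (f n x); first exact: chain_map_cyc.
  by rewrite subrr; apply: bd0.
- by move=> y /Hs[x x0 xy]; exists x.
move=> x y x0 y0 xy; split=> [xb|yb].
  by rewrite -[y]opprK -[X in - X](addKr (f n x)); apply/bd_opp/bd_add => //;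
    apply/bd_opp/chain_map_bd.
by apply: Hi => //; rewrite -[f n x](subrK y); apply: bd_add.
Qed.

Lemma injective_resolution_complex (R : comPzRingType) (X : complex R) :
  homology_bounded_above X -> injective_complex (injective_resolution X) /\
  forall n, lmod_iso (homology X n) (homology (injective_resolution X) n).
Proof.
move=> /injective_resolutionP[bddE injE [f qf]]; split.
  by split=> // n; apply: injective_rel_extendable.
by move=> n; apply: quasi_iso_homology qf.
Qed.

(** * Comparison map and removal of the lowest cohomology *)

(** Degree 0 of [E] is matched with degree [n] of [J] through the given isomorphism and a section of
    the projection of cycles onto homology. Injectivity of [J] and exactness of [E] extend the map
    to lower degrees; in higher degrees it is 0. *)
Lemma comparison_map (R : pzRingType) (E J : complex R) (n : int) :
    injective_complex J -> (forall k, k != 0 -> exact_at E k) ->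
    (forall k, n < k -> exact_at J k) -> lmod_iso (homology E 0) (homology J n) ->
  exists phi : forall i j, {linear E i -> J j},
    [/\ forall i j x, j != i + n -> phi i j x = 0,
        forall i i' j j' x, j = i + n -> j' = i' + n ->
          phi i' j' (diff E i i' x) = diff J j j' (phi i j x),
        forall i j (z : J j), i = 0 -> j = n -> cyc z ->
          exists2 x, cyc x & bd (z - phi i j x)
      & forall i j (x : E i), i = 0 -> j = n -> cyc x -> bd (phi i j x) -> bd x].
Proof.
move=> injJ exE exJ; rewrite -{1}[n]add0r => -[theta [theta' thetaK theta'K]].
have [|h hE] := @top_contraction R J n injJ exJ (0 + n); first by rewrite add0r.
pose d := diff J (0 + n + 1) (0 + n).
(* Subtracting [d (h w)] kills the boundaries, which gives a section of the
   projection of the cycles of [J] onto the homology. *)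
have [||psi0 psi0E] := injJ.2 (0 + n) (E 0) (fun x z =>
    exists (x0 : cyc x) w (w0 : cyc w),
      theta (hclass x0) = hclass w0 /\ z = w - d (h w)).
- split.
    exists (@cyc0 R E 0), 0, (@cyc0 R J (0 + n)); split; last first.
      by rewrite linear0 linear0 subr0.
    rewrite (_ : hclass (@cyc0 R E 0) = 0); last exact/hclass_eq0/bd0.
    by rewrite linear0; apply/esym/hclass_eq0/bd0.
  move=> c x _ x' _ [x0 [w [w0 [ww ->]]]] [x0' [w' [w0' [ww' ->]]]].
  exists (cycD c x0 x0'), (c *: w + w'), (cycD c w0 w0').
  rewrite -!hclassP linearP /= ww ww'; split=> //.
  by rewrite (linearP h) (linearP d) scalerBr opprD addrACA.
- move=> z [x0 [w [w0 [ww ->]]]].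
  have /bdP[v vE] : bd w.
    apply/(hclass_eq0 w0); rewrite -ww (_ : hclass x0 = 0) ?linear0//.
    exact/hclass_eq0/bd0.
  by rewrite -vE -/d [d (h _)]hE subrr.
have psi0P x (x0 : cyc x) :
    exists2 y0 : cyc (psi0 x), hclass y0 = theta (hclass x0) & bd x -> psi0 x = 0.
  have [w [w0 wE]] := hclass_surj (theta (hclass x0)).
  have psiE : psi0 x = w - d (h w) by apply: psi0E; exists x0, w, w0.
  have y0 : cyc (psi0 x) by rewrite psiE; apply: cyc_sub => //; apply: cyc_diff.
  exists y0.
    rewrite wE; apply/hclass_eq; rewrite psiE -addrA addrC addrNK.
    exact/bd_opp/bd_diff.
  move=> xb; rewrite psiE.
  have /bdP[v <-] : bd w.
    by apply/(hclass_eq0 w0); rewrite -wE ((hclass_eq0 x0).2 xb) linear0.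
  by rewrite -/d [d (h _)]hE subrr.
pose D (i : int) : {linear E i -> J (i + n)} :=
  @eqtype.dfwith _ (fun i : int => {linear E i -> J (i + n)}) (fun=> \0%R) 0 psi0 i.
(* The invariant that cycles go to cycles is what makes the map of the next degree well defined on
   boundaries. *)
have [||psi [psiD psiP]] := @descending_choice (fun i => {linear E i -> J (i + n)})
  (fun i f => forall x : E i, cyc x -> cyc (f x))
  (fun i j f g => forall x, g (diff E i j x) = diff J (i + n) (j + n) (f x)) 0 D.
- by rewrite /D eqtype.dfwith_in => x x0; have [] := psi0P x x0.
- move=> i f i0 fcyc.
  have [||g gE] := injJ.2 (i - 1 + n) (E (i - 1)) (fun y z =>
    exists2 x, y = diff E i (i - 1) x & z = diff J (i + n) (i - 1 + n) (f x)).
  + split=> [|c _ _ _ _ [x -> ->] [x' -> ->]].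
      by exists 0; rewrite !linear0.
    by exists (c *: x + x'); rewrite !linearP.
  + move=> z [x /esym dx ->]; apply: fcyc; apply: (cyc_at (m := i - 1)) => //; lia.
  have gd x : g (diff E i (i - 1) x) = diff J (i + n) (i - 1 + n) (f x).
    by apply: gE; exists x.
  exists g; split=> // y y0.
  have [||x <-] := @bd_at R E (i - 1) i y; [by apply: exE => //; lia|lia|].
  by rewrite gd; apply: cyc_diff.
have psi_0 : psi 0 = psi0 by rewrite psiD// /D eqtype.dfwith_in.
have psi_pos i : 0 < i -> forall x, psi i x = 0.
  by move=> i0 x; rewrite psiD ?/D ?eqtype.dfwith_out//; lia.
have [phi [phiE phi0]] := @extend_family R E J (fun i => i + n) psi.
exists phi; split=> //.
- move=> i i' _ _ x -> ->; rewrite !phiE.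
  have [ii'|ii'] := eqVneq i (i' + 1); last by rewrite !diff_shape ?linear0//; lia.
  have i'E : i' = i - 1 by lia.
  subst i'; have [i0|i0] := leP i 0; first by have [_] := psiP i i0.
  rewrite (psi_pos i i0) linear0.
  have [i1|i1] := eqVneq i 1; last by apply: psi_pos; lia.
  (* Passing from degree 1, where the map is 0, to degree 0 requires [psi0] to vanish on
     boundaries. *)
  subst i; rewrite [psi (1 - 1)]psi_0.
  have [_ _] := psi0P _ (cyc_diff (1 - 1) x); apply.
  exact: bd_diff.
- move=> i j z i0 jn; have {}jn : j = 0 + n by lia.
  subst i j => z0; have [x [x0 xE]] := hclass_surj (theta' (hclass z0)).
  exists x => //; rewrite phiE psi_0; have [y0 yE _] := psi0P x x0.
  by apply/(hclass_eq z0 y0); rewrite yE -xE theta'K.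
- move=> i j x i0 jn; have {}jn : j = 0 + n by lia.
  subst i j => x0; rewrite phiE psi_0; have [y0 yE _] := psi0P x x0.
  move=> /(hclass_eq0 y0); rewrite yE => tx.
  by apply/(hclass_eq0 x0)/(can_inj thetaK); rewrite tx linear0.
Qed.

(** The cone of the comparison map, which has degree [n], hence the shift [n + 1]. Surjectivity of
    [phi] on homology gives exactness in degree [n], injectivity gives it in degree [n + 1]. *)
Lemma cone_strip (R : comPzRingType) (J : complex R) (n : int) (M : lmodType R) :
    injective_complex J -> (forall k, n < k -> exact_at J k) ->
    lmod_iso (homology J n) M ->
  exists (C : complex R) phi r p,
    [/\ injective_complex C,
        @is_cone R J (injective_resolution (stalk M)) C (n + 1) phi r p,
        forall k, n <= k -> exact_at C k
      & forall k, k < n -> lmod_iso (homology J k) (homology C k)].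
Proof.
move=> injJ exJ JM.
have [injE EM] := injective_resolution_complex (stalk_bounded M).
set E := injective_resolution (stalk M) in injE EM *.
have exE k : k != 0 -> exact_at E k.
  move=> k0; apply/is_zero_homology/(lmod_iso_is_zero (EM k)).
  exact/is_zero_homology/stalk_exact.
have EJ : lmod_iso (homology E 0) (homology J n).
  apply: lmod_iso_trans (lmod_iso_sym (EM 0)) _.
  exact: lmod_iso_trans (stalk_homology0 M) (lmod_iso_sym JM).
have [phi [phi0 phid phi_surj phi_inj]] := comparison_map injJ exE exJ EJ.
have shape i j x : i + (n + 1) != j + 1 -> phi i j x = 0.
  by move=> ij; apply: phi0; lia.
have comm i j k y : phi (j - (n + 1)) k (diff E (i - (n + 1)) (j - (n + 1)) y) =
    diff J j k (phi (i - (n + 1)) j y).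
  have [ij|ij] := eqVneq i (j + 1); last first.
    by rewrite diff_shape ?linear0 ?[phi _ j _]phi0 ?linear0//; lia.
  have [jk|jk] := eqVneq j (k + 1); first by apply: phid; lia.
  by rewrite phi0 ?diff_shape//; lia.
have [r [p coneE]] : exists r p, @is_cone R J E (cone shape comm) (n + 1) phi r p.
  by do 2 eexists; exact: coneP.
exists (cone shape comm), phi, r, p; split; last 1 first.
- move=> k kn; apply: (cone_homology_iso coneE); apply: exE; lia.
- exact: cone_injective.
- exact: coneE.
move=> k nk; apply: (cone_exact coneE).
  move=> a a0; have [kn|kn] := eqVneq k n; first by apply: phi_surj => //; lia.
  exists 0; first exact: cyc0.
  by rewrite linear0 subr0; apply: exJ => //; lia.
move=> y y0; have [kn|kn] := eqVneq k (n + 1); first by apply: phi_inj => //; lia.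
by move=> _; apply: exE => //; lia.
Qed.

(** * Removing cohomology modules from below *)

Section ExtInduction.
Variables (R : comPzRingType) (N : lmodType R) (M : int -> lmodType R).

(* The indices [q] and [i] are cohomological: they stand for the homological
   degrees [- q] and [- i]. *)
Definition cohomology_from (J : complex R) (q : int) : Prop :=
  [/\ injective_complex J,
      forall k, - q < k -> exact_at J k
    & forall i, q <= i -> lmod_iso (homology J (- i)) (M i)].

Definition hom_cohomology (J : complex R) (m : int) : lmodType R :=
  homology (hom_complex N J) (- m).

(** The three clauses come from the exact sequence with terms H^(m-1)(Hom(N, C)), Ext^(m-q)(N, M q),
    H^m(Hom(N, J)), H^m(Hom(N, C)), Ext^(m+1-q)(N, M q). *)
Lemma hom_cohomology_strip (J : complex R) q : cohomology_from J q ->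
  exists2 C, cohomology_from C (q + 1) & forall m,
    [/\ is_zero (Ext (m - q) N (stalk (M q))) ->
        is_zero (Ext (m + 1 - q) N (stalk (M q))) ->
        lmod_iso (hom_cohomology J m) (hom_cohomology C m),
        is_zero (hom_cohomology C (m - 1)) -> is_zero (hom_cohomology C m) ->
        lmod_iso (Ext (m - q) N (stalk (M q))) (hom_cohomology J m)
      & is_zero (Ext (m - q) N (stalk (M q))) -> is_zero (hom_cohomology C m) ->
        is_zero (hom_cohomology J m)].
Proof.
move=> [injJ exJ JM].
have [C [phi [r [p [injC coneC exC JC]]]]] := cone_strip injJ exJ (JM q (lexx q)).
exists C.
  split=> // [k qk|i qi]; first by apply: exC; lia.
  apply: lmod_iso_trans (lmod_iso_sym (JC _ _)) _; first lia.
  by apply: JM; lia.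
have coneN := hom_cone N coneC.
move=> m; rewrite /hom_cohomology /Ext.
have e1 : - (m - q) = - m + 1 - (- q + 1) by lia.
have e2 : - (m + 1 - q) = - m - (- q + 1) by lia.
have e3 : - (m - 1) = - m + 1 by lia.
rewrite e1 e2 e3; split.
- by move=> /is_zero_homology ? /is_zero_homology ?; apply: (cone_homology_iso coneN).
- by move=> /is_zero_homology ? /is_zero_homology ?; apply: (cone_connecting_iso coneN).
move=> /is_zero_homology ? /is_zero_homology ?; apply/is_zero_homology.
exact: (cone_exact_base coneN).
Qed.

(** Induction on a bound [d] for the number of degrees from [q] to [m]. Once none is left, [J] is
    exact above homological degree [- q], which is below [- m], and [hom_exact] applies. *)
Lemma hom_cohomology_zero (J : complex R) q m : cohomology_from J q ->
    (forall i, q <= i -> i <= m -> is_zero (Ext (m - i) N (stalk (M i)))) ->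
  is_zero (hom_cohomology J m).
Proof.
have [d] : exists d : nat, m + 1 - q <= d by exists `|(m + 1 - q)%R|%N; lia.
elim: d J q => [|d IHd] J q dE Jq extM.
  case: Jq => injJ exJ _; apply/is_zero_homology.
  by apply: (@hom_exact R N J (- q)) => //; lia.
have [qm|mq] := leP q m; last by apply: (IHd _ q) => //; lia.
have [C Cq /(_ m)[_ _]] := hom_cohomology_strip Jq; apply; first exact: extM.
apply: (IHd _ (q + 1)) => //; first lia.
by move=> i qi im; apply: extM => //; lia.
Qed.

Lemma hom_cohomology_iso (J : complex R) (q t m : int) : cohomology_from J q ->
    q <= t ->
    (forall i, q <= i -> i < t -> is_zero (Ext (m - i) N (stalk (M i))) /\
      is_zero (Ext (m + 1 - i) N (stalk (M i)))) ->
  exists2 J', cohomology_from J' t &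
    lmod_iso (hom_cohomology J m) (hom_cohomology J' m).
Proof.
move=> Jq qt; have [d] : exists d : nat, t = q + d%:Z by exists `|t - q|%N; lia.
elim: d J q qt Jq => [|d IHd] J q qt Jq tE extM.
  by exists J; [rewrite tE addr0|exact: lmod_iso_refl].
have [C Cq /(_ m)[JC _ _]] := hom_cohomology_strip Jq.
have [|||J' J't CJ'] := IHd C (q + 1) _ Cq; [lia|lia| |].
  by move=> i qi it; apply: extM; lia.
exists J' => //; have [||E0 E1] := extM q; [lia|lia|].
exact: lmod_iso_trans (JC E0 E1) CJ'.
Qed.

Lemma hom_cohomology_Ext (J : complex R) (q s t : int) : cohomology_from J q ->
    q <= t ->
    (forall i, q <= i -> i < t \/ t < i <= s + t ->
      is_zero (Ext (s + t - i) N (stalk (M i)))) ->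
    (forall i, q <= i -> i < t -> is_zero (Ext (s + t + 1 - i) N (stalk (M i)))) ->
    (forall i, t < i -> i <= s + t - 1 ->
      is_zero (Ext (s + t - 1 - i) N (stalk (M i)))) ->
  lmod_iso (hom_cohomology J (s + t)) (Ext s N (stalk (M t))).
Proof.
move=> Jq qt ext0 ext1 extm.
have [|J' J't JJ'] := @hom_cohomology_iso J q t (s + t) Jq qt.
  by move=> i qi it; split; [apply: ext0 => //; left|apply: ext1].
apply: lmod_iso_trans JJ' (lmod_iso_sym _).
have [C Ct /(_ (s + t))[_ H _]] := hom_cohomology_strip J't.
rewrite addrK in H; apply: H; apply: (hom_cohomology_zero Ct) => i ti im.
  by apply: extm => //; lia.
by apply: ext0; [lia|right; lia].
Qed.

End ExtInduction.

(** * Passage to the torsion complex and conclusion *)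

Lemma hom_valP (R : comPzRingType) (N M : lmodType R) c (u v : hom_module N M) y :
  val (c *: u + v) y = c *: val u y + val v y.
Proof. by []. Qed.

Lemma hom_torsion_complex (R : comPzRingType) (b : ideal R) (N : lmodType R)
    (X : complex R) n :
    (forall x, x \in b -> forall y : N, x *: y = 0) ->
  lmod_iso (homology (hom_complex N X) n)
           (homology (hom_complex N (torsion_complex b X)) n).
Proof.
move=> bN.
have uT (M : lmodType R) (u : hom_module N M) y : val u y \in @torsion_pred R b M.
  (* The exponent 1 suffices, since the values of [u] are killed by [b] itself. *)
  apply/torsion_predP; exists 1 => _ /ideal_mul_predP[m [f [g [fb _ ->]]]].
  rewrite scaler_suml big1// => i _; rewrite mulrC -scalerA.
  have uL := hom_linear u.
  have -> : f i *: val u y = val u (f i *: y).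
    exact/esym/(GRing.scalable_linear uL).
  rewrite bN// [X in _ *: X](_ : _ = 0) ?scaler0//.
  exact: (linear0 (pack_linear uL)).
have lift (M : lmodType R) (u : hom_module N M) :
    exists v : hom_module N (torsion b M), forall y, val (val v y) = val u y.
  have lin_v : linear (fun y => Submod (uT M u y) : torsion b M).
    by move=> c x y; apply: val_inj; apply: hom_linear.
  by exists (hom_of_linear (pack_linear lin_v)).
pose G k (u : hom_complex N X k) (v : hom_complex N (torsion_complex b X) k) :=
  forall y, val (val v y) = val u y.
have G_cyc k u v : G k u v -> (cyc u <-> cyc v).
  move=> uv; split=> [/cyc_hom u0|/cyc_hom v0]; apply/cyc_hom => y.
    by apply/cyc_torsion; rewrite uv.
  by rewrite -uv; apply/cyc_torsion.
apply: (homology_iso (G := G n)).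
- split=> [|c u v u' v' uv uv'] y //.
  rewrite /G [in RHS]hom_valP -uv -uv' -linearP; congr val; exact: hom_valP.
- by move=> u u0; have [v uv] := lift _ u; exists v => //; apply/(G_cyc n u v).
- move=> v v0; pose u := hom_map N (val : {linear torsion b (X n) -> X n}) v.
  by exists u => //; apply/(G_cyc n u v).
move=> u v _ _ uv; split=> [/bdP[w wE]|/bdP[w wE]]; apply/bdP.
  have [w' ww'] := lift _ w; exists w'.
  apply/val_inj/funext => y; apply: val_inj; rewrite uv -wE.
  by congr (diff X (n + 1) n _); apply: ww'.
exists (hom_map N (val : {linear torsion b (X (n + 1)) -> X (n + 1)}) w).
by apply/val_inj/funext => y; rewrite -uv -wE.
Qed.

(** The finite [t] excludes an exact complex, whose supremum is [-oo], and boundedness excludes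
    [+oo]. *)
Lemma homology_supP (R : pzRingType) (X : complex R) (t : int) :
    (- homology_sup X <= t%:E)%E ->
    homology_bounded_above X ->
  exists2 p : int, homology_sup X = p%:E & forall k, p < k -> exact_at X k.
Proof.
rewrite /homology_sup /supremum.
case: ifPn => [_ /=|S0]; first by [].
(* A set without supremum would get the default value [-oo], which the bound by [t] rules out as
   well. *)
case: xgetP => [y yE [uby lby] _|]; last by [].
move=> [N XN].
have yp k : ~ is_zero (homology X k) -> (k%:E <= y)%E by move=> Xk; apply: uby; exists k.
have yN : (y <= N%:E)%E.
  apply: lby => _ [k Xk <-]; rewrite lee_fin leNgt.
  by apply/negP => /XN.
case: y {yE} uby lby yp yN => [p| |] // uby lby yp yN.
  exists p => // k pk; apply/is_zero_homology; apply: contrapT => /yp.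
  by rewrite lee_fin leNgt pk.
have /set0P[_ [k Xk _]] := S0.
by have := yp k Xk.
Qed.

Theorem theorem4p4 (R : comPzRingType) (noethR : noetherian R)
    (a b : ideal R) (sub_ba : {subset b <= a})
    (X : complex R) (bddX : homology_bounded_above X)
    (s t : int) (s_ge0 : 0 <= s) (t_ge : (- homology_sup X <= t%:E)%E)
    (H1 : forall i : int,
      ((- homology_sup X <= i%:E)%E /\ i < t) \/ (t + 1 <= i /\ i <= s + t) ->
      is_zero (Ext (s + t - i) (quotmod a) (stalk (local_cohomology b i X))))
    (H2 : forall i : int,
      0 <= i -> (i%:E <= t%:E + homology_sup X)%E ->
      is_zero (Ext (s + 1 + i) (quotmod a)
                 (stalk (local_cohomology b (t - i) X))))
    (H3 : forall i : int,
      0 <= i -> i <= s - 1 ->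
      is_zero (Ext (s - 1 - i) (quotmod a)
                 (stalk (local_cohomology b (t + i) X)))) :
  lmod_iso (Ext (s + t) (quotmod a) X)
    (Ext s (quotmod a) (stalk (local_cohomology b t X))).
Proof.
have [p supX exX] := homology_supP t_ge bddX.
have leE i : (- homology_sup X <= i%:E)%E = (- p <= i) by rewrite supX -EFinN lee_fin.
rewrite leE in t_ge.
have [[[B IB] extI] XI] := injective_resolution_complex bddX.
have exI k : p < k -> exact_at (injective_resolution X) k.
  by move=> /exX/is_zero_homology/(lmod_iso_is_zero (XI k))/is_zero_homology.
have bN x : x \in b -> forall y : quotmod a, x *: y = 0.
  move=> /sub_ba xa y; rewrite -[y]quot_reprK [LHS]quot_piZ.
  apply/quot_pi_eq0; rewrite [_ *: _]mulrC.
  exact: (rpredZ (s := a)).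
apply: (lmod_iso_trans
  (hom_torsion_complex (injective_resolution X) (- (s + t)) bN)).
pose M i := local_cohomology b i X.
apply: (@hom_cohomology_Ext R (quotmod a) M (RGamma b X) (- p) s t) => //.
- split; last by move=> i _; apply: lmod_iso_refl.
    split; last by move=> n; apply: torsion_extendable.
    by exists B => n /IB In x; apply: val_inj; apply: In.
  by rewrite opprK; apply: torsion_exact exI; split=> //; exists B.
- by move=> i pi [it|it]; apply: H1; [left; rewrite leE|right; lia].
(* [H2] and [H3] are indexed by the distance of a degree from [t], below and above it
   respectively. *)
- move=> i pi it; have := H2 (t - i).
  have -> : t - (t - i) = i by lia.
  have -> : s + 1 + (t - i) = s + t + 1 - i by lia.
  by apply; [lia|rewrite supX -EFinD lee_fin; lia].
move=> i ti im; have := H3 (i - t).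
have -> : t + (i - t) = i by lia.
have -> : s - 1 - (i - t) = s + t - 1 - i by lia.
by apply; lia.
Qed.
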